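(* Assume (A0) and (A1), and let $T>0$. Let $u$ be a sub-solution and $v$ a super-solution of $u_t+H(x,u_x)=0$ on $J_T$ with initial condition $u_0$ (i.e. $u(0,\cdot)\le u_0$, $v(0,\cdot)\ge u_0$). Assume there is $C_T>0$ such that for all $(t,x)\in J_T$, $$u(t,x)\le C_T(1+d(x,0)),\qquad v(t,x)\ge -C_T(1+d(x,0)).$$ Then $u\le v$ on $J_T$.
   Context: Junction: fix an integer $N\ge1$ and $N$ distinct unit vectors $e_1,\dots,e_N\in\mathbb{R}^2$. Set $J_i=[0,\infty)e_i$, $J_i^*=J_i\setminus\{0\}$, $J=\bigcup_{i=1}^NJ_i$, $J^*=J\setminus\{0\}$, $I_N=\{1,\dots,N\}$. Each $x\in J_i$ is written $x=x_ie_i$ with $x_i\ge0$. $J$ carries the geodesic distance $d(x,y)=|x-y|$ if $x,y$ lie in a common branch $J_i$, and $d(x,y)=|x|+|y|$ otherwise. For $T>0$, $J_T=(0,T)\times J$; balls $B((t,x),r)$ are taken in $(0,\infty)\times J$. For $u$ defined on $J_T$, $u^i$ is its restriction to $(0,T)\times J_i$, viewed as a function of $(t,x_i)\in(0,T)\times[0,\infty)$. $C^1_*(J_T)$ is the set of continuous $u$ on $J_T$ with each $u^i\in C^1((0,T)\times[0,\infty))$ (one-sided derivative at $x_i=0$); for such $u$, $u_t$ is the time derivative, $u^i_x=\partial u^i/\partial x_i$, $u_x(t,x)=u^i_x(t,x)$ if $x\in J_i^*$, and $u_x(t,0)=(u^1_x(t,0),\dots,u^N_x(t,0))$. (A0):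 $u_0:J\to\mathbb{R}$ is Lipschitz continuous with respect to $d$. (A1): there is $\gamma>0$ such that for each $i\in I_N$, $L_i\in C^2(\mathbb{R})$ with $L_i''\ge\gamma$; $H_i(p)=\sup_{q\in\mathbb{R}}(pq-L_i(q))$ and $H_i^-(p)=\sup_{q\le0}(pq-L_i(q))$. Hamiltonian: $H(x,p)=H_i(p)$ for $x\in J_i^*$, $p\in\mathbb{R}$; $H(0,p)=\max_{i\in I_N}H_i^-(p_i)$ for $p=(p_1,\dots,p_N)\in\mathbb{R}^N$. Viscosity solutions: $u:[0,T)\times J\to\mathbb{R}$ is a sub-solution (resp. super-solution) of $u_t+H(x,u_x)=0$ on $J_T$ if it is upper (resp. lower) semicontinuous and for every $\phi\in C^1_*(J_T)$, every $P=(t,x)\in J_T$ and $r>0$ with $u\le\phi$ (resp. $u\ge\phi$) on $B(P,r)$ and $u(P)=\phi(P)$: if $x\in J_i^*$ then $\phi_t(t,x)+H_i(\phi_x(t,x))\le0$ (resp. $\ge0$); if $x=0$ then $\phi_t(t,0)+\max_{i\in I_N}H_i^-(\phi^i_x(t,0))\le0$ (resp. $\ge0$). It is a sub-solution (resp. super-solution) of the problem with initial condition $u_0$ if in addition $u(0,\cdot)\le u_0$ (resp. $\ge u_0$). *)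

(* Defs.v *)
From Stdlib Require Import Reals Lra List ClassicalEpsilon.
Open Scope R_scope.

Definition pt := (R * R)%type.
Definition origin : pt := (0, 0).
Definition smul (s : R) (v : pt) : pt := (s * fst v, s * snd v).
Definition vsub (x y : pt) : pt := (fst x - fst y, snd x - snd y).
Definition norm2 (v : pt) : R := sqrt (fst v ^ 2 + snd v ^ 2).

(** Junction data: N >= 1 distinct unit vectors e_0, ..., e_{N-1}
    (indices shifted by one w.r.t. the paper's 1..N). *)
Definition junction (N : nat) (e : nat -> pt) : Prop :=
  (1 <= N)%nat /\
  (forall i, (i < N)%nat -> norm2 (e i) = 1) /\
  (forall i j, (i < N)%nat -> (j < N)%nat -> e i = e j -> i = j).

Definition on_branch (e : nat -> pt) (i : nat) (x : pt) : Prop :=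
  exists s, 0 <= s /\ x = smul s (e i).

Definition inJ (N : nat) (e : nat -> pt) (x : pt) : Prop :=
  exists i, (i < N)%nat /\ on_branch e i x.

Definition dJ (N : nat) (e : nat -> pt) (x y : pt) : R :=
  if excluded_middle_informative
       (exists i, (i < N)%nat /\ on_branch e i x /\ on_branch e i y)
  then norm2 (vsub x y) else norm2 x + norm2 y.

Definition lipschitzJ (N : nat) (e : nat -> pt) (u0 : pt -> R) : Prop :=
  exists K, forall x y, inJ N e x -> inJ N e y ->
    Rabs (u0 x - u0 y) <= K * dJ N e x y.

Definition assumption_A1 (N : nat) (L : nat -> R -> R) (gamma : R) : Prop :=
  0 < gamma /\
  forall i, (i < N)%nat ->
    exists L1 L2 : R -> R,
      (forall q, derivable_pt_lim (L i) q (L1 q)) /\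
      (forall q, derivable_pt_lim L1 q (L2 q)) /\
      continuity L2 /\
      (forall q, gamma <= L2 q).

(** Supremum of a set of reals (meaningful when the lub exists). *)
Definition supR (P : R -> Prop) : R :=
  epsilon (inhabits 0) (fun m => is_lub P m).

Definition Ham (L : nat -> R -> R) (i : nat) (p : R) : R :=
  supR (fun y => exists q, y = p * q - L i q).
Definition HamMinus (L : nat -> R -> R) (i : nat) (p : R) : R :=
  supR (fun y => exists q, q <= 0 /\ y = p * q - L i q).

Definition Hjunc (N : nat) (L : nat -> R -> R) (p : nat -> R) : R :=
  fold_right Rmax (HamMinus L 0 (p 0%nat))
    (map (fun i => HamMinus L i (p i)) (seq 0 N)).

Definition cont_strip (T : R) (g : R -> R -> R) : Prop :=
  forall t s, 0 < t < T -> 0 <= s ->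
  forall eps, 0 < eps -> exists del, 0 < del /\
    forall t' s', 0 < t' < T -> 0 <= s' ->
      Rabs (t' - t) < del -> Rabs (s' - s) < del ->
      Rabs (g t' s' - g t s) < eps.

Definition C1_strip (T : R) (f ft fx : R -> R -> R) : Prop :=
  (forall t s, 0 < t < T -> 0 <= s ->
   forall eps, 0 < eps -> exists del, 0 < del /\
     forall t' s', 0 < t' < T -> 0 <= s' ->
       Rabs (t' - t) < del -> Rabs (s' - s) < del ->
       Rabs (f t' s' - f t s - ft t s * (t' - t) - fx t s * (s' - s))
         <= eps * (Rabs (t' - t) + Rabs (s' - s))) /\
  cont_strip T ft /\ cont_strip T fx.

(** phi in C^1_*(J_T), with time derivative Dt and branch space
    derivatives Dx i (as functions of (t, x_i)). *)
Definition C1star (N : nat) (e : nat -> pt) (T : R)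
    (phi Dt : R -> pt -> R) (Dx : nat -> R -> R -> R) : Prop :=
  (forall t x, 0 < t < T -> inJ N e x ->
   forall eps, 0 < eps -> exists del, 0 < del /\
     forall s y, 0 < s < T -> inJ N e y ->
       Rabs (s - t) < del -> dJ N e x y < del ->
       Rabs (phi s y - phi t x) < eps) /\
  (forall i, (i < N)%nat ->
     C1_strip T (fun t s => phi t (smul s (e i)))
                (fun t s => Dt t (smul s (e i))) (Dx i)).

Definition uscJ (N : nat) (e : nat -> pt) (T : R) (u : R -> pt -> R) : Prop :=
  forall t x, 0 <= t < T -> inJ N e x ->
  forall eps, 0 < eps -> exists del, 0 < del /\
    forall s y, 0 <= s < T -> inJ N e y ->
      Rabs (s - t) < del -> dJ N e x y < del -> u s y < u t x + eps.
Definition lscJ (N : nat) (e : nat -> pt) (T : R) (u : R -> pt -> R) : Prop :=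
  forall t x, 0 <= t < T -> inJ N e x ->
  forall eps, 0 < eps -> exists del, 0 < del /\
    forall s y, 0 <= s < T -> inJ N e y ->
      Rabs (s - t) < del -> dJ N e x y < del -> u t x - eps < u s y.

(** Viscosity sub-solution of u_t + H(x,u_x) = 0 on J_T.
    Balls B((t,x),r) use the metric max(|s-t|, d(x,y)), restricted to J_T. *)
Definition subsolution (N : nat) (e : nat -> pt) (L : nat -> R -> R) (T : R)
    (u : R -> pt -> R) : Prop :=
  uscJ N e T u /\
  forall phi Dt Dx, C1star N e T phi Dt Dx ->
  forall t x r, 0 < t < T -> inJ N e x -> 0 < r ->
    (forall s y, 0 < s < T -> inJ N e y -> Rabs (s - t) < r ->
       dJ N e x y < r -> u s y <= phi s y) ->
    u t x = phi t x ->
    (forall i s, (i < N)%nat -> 0 < s -> x = smul s (e i) ->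
       Dt t x + Ham L i (Dx i t s) <= 0) /\
    (x = origin -> Dt t x + Hjunc N L (fun i => Dx i t 0) <= 0).

Definition supersolution (N : nat) (e : nat -> pt) (L : nat -> R -> R) (T : R)
    (u : R -> pt -> R) : Prop :=
  lscJ N e T u /\
  forall phi Dt Dx, C1star N e T phi Dt Dx ->
  forall t x r, 0 < t < T -> inJ N e x -> 0 < r ->
    (forall s y, 0 < s < T -> inJ N e y -> Rabs (s - t) < r ->
       dJ N e x y < r -> phi s y <= u s y) ->
    u t x = phi t x ->
    (forall i s, (i < N)%nat -> 0 < s -> x = smul s (e i) ->
       0 <= Dt t x + Ham L i (Dx i t s)) /\
    (x = origin -> 0 <= Dt t x + Hjunc N L (fun i => Dx i t 0)).

Definition subsolution_init N e L T (u0 : pt -> R) u : Prop :=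
  subsolution N e L T u /\ (forall x, inJ N e x -> u 0 x <= u0 x).
Definition supersolution_init N e L T (u0 : pt -> R) v : Prop :=
  supersolution N e L T v /\ (forall x, inJ N e x -> u0 x <= v 0 x).

(* Main.v *)
(** The proof goes through the underlying optimal control problem.  A sub-solution
    [u] is suboptimal along straight paths in a branch: its increase along such a
    path is at most the action of the path.  This follows by maximising [u] minus
    a steep penalisation of the distance to the path; on the other branches a
    linear penalisation is enough, because the Hamiltonians are coercive.

    For the super-solution [v], fix a target point [x] and compare [v] with minus
    the least action needed to reach [x] at a time slightly after [S].  This
    function is a supremum of smooth solutions, each given by an explicit path
    (direct, or through the vertex with a possible waiting time there), so it can
    be used to test [v] from below without doubling variables; and it tends to
    minus infinity quadratically, so no penalisation at infinity is needed.  At a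
    negative minimum of the difference, perturbing the starting point of the
    optimal path gives an admissible test function that contradicts the
    super-solution property.  At time [0] the comparison holds because [u] is
    suboptimal along the same paths. *)

Require Import Defs.
From Stdlib Require Import Reals Lra Lia List Classical ClassicalEpsilon.
From Coquelicot Require Import Compactness.
Open Scope R_scope.

(** * Finite families and attained minima *)

(** At the vertex the Hamiltonian sees only speeds [q <= 0], that is motion into the vertex. For the
    sub-solution this tests inward paths only; outward ones are limits of paths starting at a
    positive distance. For the super-solution every branch needs a slope whose [HamMinus] is small,
    and a path entering the vertex at a well chosen speed provides it. The target time is [S + eta]
    because the action degenerates when the remaining time tends to 0; standing still during [eta]
    costs only [eta * L k 0], and [u] is shifted by [eta] to match. The barrier [lam / (t2 - t)]
    keeps minima away from the final time, and its positive slope makes the tested inequality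
    strict. Actions, penalties and barrier are convex: tangents from below give semicontinuity,
    local quadratic bounds from above give test functions. Hence quadratic polynomials on each
    branch suffice as tests. Waiting at the vertex costs at best the minimum of the [L j 0] per unit
    of time, which is minus the largest of the minima of the [Ham L j]. *)

Lemma fin_radius (N : nat) (P : nat -> R -> Prop) :
  (forall j d d', P j d -> d' <= d -> P j d') ->
  (forall j, (j < N)%nat -> exists d, 0 < d /\ P j d) ->
  exists d, 0 < d /\ forall j, (j < N)%nat -> P j d.
Proof.
  intros Hmon. induction N as [|N IH]; intros H.
  - exists 1. split; [lra|]. intros j Hj. lia.
  - destruct IH as [d [Hd HP]]; [intros j Hj; apply H; lia|].
    destruct (H N ltac:(lia)) as [d' [Hd' HP']].
    exists (Rmin d d'). split; [apply Rmin_glb_lt; lra|].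
    intros j Hj. destruct (Nat.eq_dec j N) as [->|Hne].
    + apply Hmon with d'; [exact HP'|apply Rmin_r].
    + apply Hmon with d; [apply HP; lia|apply Rmin_l].
Qed.

Lemma fin_bound (N : nat) (P : nat -> R -> Prop) :
  (forall j c c', P j c -> c <= c' -> P j c') ->
  (forall j, (j < N)%nat -> exists c, P j c) ->
  exists c, forall j, (j < N)%nat -> P j c.
Proof.
  intros Hmon. induction N as [|N IH]; intros H.
  - exists 0. intros j Hj. lia.
  - destruct IH as [c HP]; [intros j Hj; apply H; lia|].
    destruct (H N ltac:(lia)) as [c' HP'].
    exists (Rmax c c'). intros j Hj. destruct (Nat.eq_dec j N) as [->|Hne].
    + apply Hmon with c'; [exact HP'|apply Rmax_r].
    + apply Hmon with c; [apply HP; lia|apply Rmax_l].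
Qed.

Lemma fin_family_min (A : Type) (D : nat -> A -> Prop) (F : nat -> A -> R) (N : nat) :
  (1 <= N)%nat ->
  (forall j, (j < N)%nat ->
     exists a, D j a /\ forall a', D j a' -> F j a <= F j a') ->
  exists j a, (j < N)%nat /\ D j a /\
    forall j' a', (j' < N)%nat -> D j' a' -> F j a <= F j' a'.
Proof.
  intros HN H. induction N as [|N IH]; [lia|].
  destruct (H N ltac:(lia)) as [a [Da Ma]].
  destruct (Nat.eq_dec N 0) as [->|HN0].
  - exists 0%nat, a. repeat split; auto. intros j' a' Hj'.
    replace j' with 0%nat by lia. auto.
  - destruct IH as [j [b [Hj [Db Mb]]]]; [lia|intros i Hi; apply H; lia|].
    destruct (Rle_dec (F N a) (F j b)) as [Hle|Hgt].
    + exists N, a. repeat split; auto. intros j' a' Hj' Da'.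
      destruct (Nat.eq_dec j' N) as [->|Hne]; [auto|].
      apply Rle_trans with (1 := Hle). apply Mb; [lia|auto].
    + exists j, b. repeat split; auto. intros j' a' Hj' Da'.
      destruct (Nat.eq_dec j' N) as [->|Hne]; [specialize (Ma a' Da'); lra|].
      apply Mb; [lia|auto].
Qed.

Lemma list_argmin (A : Type) (g : A -> R) (l : list A) :
  l <> nil -> exists t, In t l /\ forall t', In t' l -> g t <= g t'.
Proof.
  induction l as [|x l IH]; [easy|]. intros _.
  destruct l as [|y l].
  - exists x. split; [now left|]. intros t' [->|[]]. lra.
  - destruct IH as [t [Ht Hm]]; [easy|].
    destruct (Rle_dec (g x) (g t)) as [Hle|Hgt].
    + exists x. split; [now left|]. intros t' [->|Ht']; [lra|].
      specialize (Hm t' Ht'). lra.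
    + exists t. split; [now right|]. intros t' [->|Ht']; [lra|auto].
Qed.

(* In the semicontinuity hypothesis [m] is arbitrary at points outside [Dom]:
   there [f] has to blow up, so that [Dom] need not be closed. *)
Lemma lsc_attains_min (Dom : R -> R -> R -> Prop) (f : R -> R -> R -> R)
    x0 y0 z0 a1 b1 a2 b2 a3 b3 :
  Dom x0 y0 z0 ->
  (forall x y z, Dom x y z -> f x y z <= f x0 y0 z0 ->
     a1 <= x <= b1 /\ a2 <= y <= b2 /\ a3 <= z <= b3) ->
  (forall x y z m, a1 <= x <= b1 -> a2 <= y <= b2 -> a3 <= z <= b3 ->
     (Dom x y z -> m < f x y z) ->
     exists d, 0 < d /\ forall x' y' z', Dom x' y' z' ->
       Rabs (x' - x) < d -> Rabs (y' - y) < d -> Rabs (z' - z) < d ->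
       m < f x' y' z') ->
  exists x y z, Dom x y z /\
    forall x' y' z', Dom x' y' z' -> f x y z <= f x' y' z'.
Proof.
  intros D0 Hbox Hlsc. apply NNPP. intros Hno.
  (* Without a minimum every point is beaten by a point of the sublevel set, and by semicontinuity
     so is a whole neighbourhood. In a finite cover the lowest of the beating points is itself
     beaten by another one. *)
  assert (Hbet : forall x y z, Dom x y z ->
    exists x' y' z', Dom x' y' z' /\ f x' y' z' <= f x0 y0 z0 /\
      f x' y' z' < f x y z).
  { intros x y z D. apply NNPP. intros H. apply Hno.
    destruct (Rle_dec (f x y z) (f x0 y0 z0)) as [Hle|Hgt].
    - exists x, y, z. split; [exact D|]. intros x' y' z' D'.
      destruct (Rle_dec (f x y z) (f x' y' z')) as [?|Hlt]; [auto|].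
      exfalso. apply H. exists x', y', z'. repeat split; auto; lra.
    - exfalso. apply H. exists x0, y0, z0. repeat split; auto; lra. }
  pose (bd := bounded_n 3 (a1, (a2, (a3, tt))) (b1, (b2, (b3, tt)))).
  assert (Hloc : forall p : Tn 3 R, exists wd : (R * R * R) * posreal, bd p ->
     let '(wx, wy, wz, d) := wd in let '(x, (y, (z, _))) := p in
     Dom wx wy wz /\ f wx wy wz <= f x0 y0 z0 /\
     forall x' y' z', Dom x' y' z' ->
       Rabs (x' - x) < d -> Rabs (y' - y) < d -> Rabs (z' - z) < d ->
       f wx wy wz < f x' y' z').
  { intros [x [y [z []]]].
    destruct (classic (bd (x, (y, (z, tt))))) as [Hb|Hb].
    2:{ exists (x, y, z, mkposreal 1 Rlt_0_1). tauto. }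
    assert (Hw : exists wx wy wz, Dom wx wy wz /\ f wx wy wz <= f x0 y0 z0 /\
      (Dom x y z -> f wx wy wz < f x y z)).
    { destruct (classic (Dom x y z)) as [D|D].
      - destruct (Hbet x y z D) as (wx & wy & wz & ? & ? & ?).
        exists wx, wy, wz. auto.
      - exists x0, y0, z0. repeat split; auto; [lra|tauto]. }
    destruct Hw as (wx & wy & wz & Dw & Lw & Sw).
    pose proof Hb as Hb'. cbn in Hb'.
    destruct (Hlsc x y z (f wx wy wz)) as [d [Hd Hf]]; try tauto.
    exists (wx, wy, wz, mkposreal d Hd). intros _. auto. }
  pose (W := fun p => proj1_sig (constructive_indefinite_description _ (Hloc p))).
  assert (HW : forall p, bd p ->
     let '(wx, wy, wz, d) := W p in let '(x, (y, (z, _))) := p in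
     Dom wx wy wz /\ f wx wy wz <= f x0 y0 z0 /\
     forall x' y' z', Dom x' y' z' ->
       Rabs (x' - x) < d -> Rabs (y' - y) < d -> Rabs (z' - z) < d ->
       f wx wy wz < f x' y' z').
  { intros p. exact (proj2_sig (constructive_indefinite_description _ (Hloc p))). }
  (* The finite cover exists up to a double negation, which suffices for the goal [False]. *)
  apply (compactness_list 3 (a1, (a2, (a3, tt))) (b1, (b2, (b3, tt)))
           (fun p => snd (W p))).
  intros [l Hl].
  assert (B0 : bd (x0, (y0, (z0, tt)))).
  { cbn. destruct (Hbox x0 y0 z0 D0) as (? & ? & ?); [lra|]. tauto. }
  pose (g := fun p => let '(wx, wy, wz) := fst (W p) in f wx wy wz).
  (* [W] carries information only at points of the box. *)
  pose (l' := filter (fun p => if excluded_middle_informative (bd p)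
                               then true else false) l).
  assert (Hl' : forall p, In p l' <-> In p l /\ bd p).
  { intros p. unfold l'. rewrite filter_In.
    destruct (excluded_middle_informative (bd p)); intuition congruence. }
  destruct (list_argmin _ g l') as [t [Ht Hmin]].
  { intros E. destruct (Hl _ B0) as [t [Ht [Bt _]]].
    assert (In t l') by (apply Hl'; auto). rewrite E in H. destruct H. }
  apply Hl' in Ht. destruct Ht as [_ Bt].
  pose proof (HW t Bt) as Ht. unfold g in Hmin.
  destruct (W t) as [[[wx wy] wz] d] eqn:Et.
  destruct t as [tx [ty [tz []]]]. destruct Ht as (Dw & Lw & _).
  destruct (Hl (wx, (wy, (wz, tt)))) as [k [Hk [Bk Ck]]].
  { destruct (Hbox wx wy wz Dw Lw) as (? & ? & ?). cbn. tauto. }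
  assert (Hk' : In k l') by (apply Hl'; auto).
  specialize (Hmin k Hk'). pose proof (HW k Bk) as HWk.
  destruct (W k) as [[[kx ky] kz] dk] eqn:Ek.
  destruct k as [k1 [k2 [k3 []]]]. cbn in Ck, Hmin. destruct HWk as (_ & _ & HWk).
  destruct Ck as (C1 & C2 & C3 & _).
  specialize (HWk wx wy wz Dw C1 C2 C3). lra.
Qed.

(** Meant for the tangent plane of a convex term: an affine minorant that is exact at the base point
    transfers lower semicontinuity to the sum. *)
Lemma lsc_plus_affine (W : R -> R -> R) (D : R -> R -> Prop) (x y z A a1 a2 a3 m : R) :
  (forall eps, 0 < eps -> exists d, 0 < d /\ forall x' y', D x' y' ->
     Rabs (x' - x) < d -> Rabs (y' - y) < d -> W x y - eps < W x' y') ->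
  m < W x y + A ->
  exists d, 0 < d /\ forall x' y' z', D x' y' ->
    Rabs (x' - x) < d -> Rabs (y' - y) < d -> Rabs (z' - z) < d ->
    m < W x' y' + (A + a1 * (x' - x) + a2 * (y' - y) + a3 * (z' - z)).
Proof.
  intros HW Hm. set (eps := (W x y + A - m) / 2).
  assert (He : 0 < eps) by (unfold eps; lra).
  destruct (HW eps He) as [d [Hd HWd]].
  set (B := Rabs a1 + Rabs a2 + Rabs a3 + 1).
  assert (HB : 0 < B) by (unfold B; pose proof (Rabs_pos a1);
    pose proof (Rabs_pos a2); pose proof (Rabs_pos a3); lra).
  exists (Rmin d (eps / B)). split.
  { apply Rmin_glb_lt; [lra|]. now apply Rdiv_lt_0_compat. }
  intros x' y' z' D' Hx Hy Hz.
  assert (HeB : eps / B * B = eps) by (field; lra).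
  set (r := eps / B) in *. pose proof (Rmin_l d r). pose proof (Rmin_r d r).
  specialize (HWd x' y' D' ltac:(lra) ltac:(lra)).
  assert (Hlin : forall a h, Rabs h < r -> - (Rabs a * r) <= a * h).
  { intros a h Hh. pose proof (Rabs_pos a). pose proof (Rle_abs (- (a * h))) as Q.
    rewrite Rabs_Ropp, Rabs_mult in Q.
    assert (Rabs a * Rabs h <= Rabs a * r) by (apply Rmult_le_compat_l; lra). lra. }
  pose proof (Hlin a1 (x' - x) ltac:(lra)). pose proof (Hlin a2 (y' - y) ltac:(lra)).
  pose proof (Hlin a3 (z' - z) ltac:(lra)).
  assert (0 < r) by (apply Rdiv_lt_0_compat; lra).
  unfold B in HeB. unfold eps in *. nra.
Qed.

(** * Test functions on the junction *)

Lemma norm2_smul (v : pt) (s : R) : norm2 v = 1 -> norm2 (smul s v) = Rabs s.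
Proof.
  unfold norm2, smul. destruct v as [a b]. cbn [fst snd]. intros H.
  replace ((s * a) ^ 2 + (s * b) ^ 2) with (Rsqr s * (a ^ 2 + b ^ 2))
    by (unfold Rsqr; ring).
  rewrite sqrt_mult; [|apply Rle_0_sqr|nra]. rewrite H, sqrt_Rsqr_abs. ring.
Qed.

Lemma smul_0 (v : pt) : smul 0 v = origin.
Proof. unfold smul, origin. f_equal; ring. Qed.

Lemma vsub_smul (v : pt) (s s' : R) : vsub (smul s v) (smul s' v) = smul (s - s') v.
Proof. unfold vsub, smul. cbn. f_equal; ring. Qed.

Lemma norm2_branch N e i s : junction N e -> (i < N)%nat -> 0 <= s ->
  norm2 (smul s (e i)) = s.
Proof.
  intros (_ & H & _) Hi Hs. rewrite norm2_smul by auto. apply Rabs_pos_eq, Hs.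
Qed.

Lemma smul_branch_inj N e i j s s' : junction N e -> (i < N)%nat -> (j < N)%nat ->
  0 < s -> 0 <= s' -> smul s (e i) = smul s' (e j) -> i = j /\ s = s'.
Proof.
  intros J Hi Hj Hs Hs' E.
  assert (Es : s = s').
  { rewrite <- (norm2_branch N e i s), <- (norm2_branch N e j s') by (auto; lra).
    now rewrite E. }
  split; [|exact Es]. subst s'. destruct J as (_ & _ & J). apply J; auto.
  unfold smul in E. injection E as E1 E2.
  destruct (e i), (e j); cbn in *. f_equal; eapply Rmult_eq_reg_l; eauto; lra.
Qed.

Lemma inJ_branch N e i s : (i < N)%nat -> 0 <= s -> inJ N e (smul s (e i)).
Proof. intros Hi Hs. exists i. split; [auto|]. exists s. auto. Qed.

Lemma dJ_same N e i s s' : junction N e -> (i < N)%nat -> 0 <= s -> 0 <= s' ->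
  dJ N e (smul s (e i)) (smul s' (e i)) = Rabs (s - s').
Proof.
  intros J Hi Hs Hs'. unfold dJ.
  destruct (excluded_middle_informative _) as [H|H].
  - rewrite vsub_smul, norm2_smul; [auto|]. apply J, Hi.
  - exfalso. apply H. exists i. repeat split; auto; eexists; eauto.
Qed.

Lemma dJ_diff N e i j s s' : junction N e -> (i < N)%nat -> (j < N)%nat -> i <> j ->
  0 <= s -> 0 <= s' -> dJ N e (smul s (e i)) (smul s' (e j)) = s + s'.
Proof.
  intros J Hi Hj Hne Hs Hs'.
  destruct (Rle_lt_or_eq_dec 0 s Hs) as [Ps|<-].
  2:{ rewrite smul_0, <- (smul_0 (e j)), dJ_same by (auto; lra).
      rewrite Rabs_minus_sym, Rabs_pos_eq; lra. }
  destruct (Rle_lt_or_eq_dec 0 s' Hs') as [Ps'|<-].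
  2:{ rewrite (smul_0 (e j)), <- (smul_0 (e i)), dJ_same by (auto; lra).
      rewrite Rabs_pos_eq; lra. }
  unfold dJ. destruct (excluded_middle_informative _) as [H|H].
  - exfalso. destruct H as (k & Hk & (r & Hr & Er) & (r' & Hr' & Er')).
    destruct (smul_branch_inj N e i k s r) as [-> _]; auto.
    destruct (smul_branch_inj N e j k s' r') as [-> _]; auto.
  - rewrite !(norm2_branch N e) by auto. reflexivity.
Qed.

(** At the origin every index qualifies; the choice is harmless because the coefficients it selects
    multiply powers of [norm2 x = 0]. *)
Definition branch_index (N : nat) (e : nat -> pt) (x : pt) : nat :=
  epsilon (inhabits 0%nat) (fun i => (i < N)%nat /\ on_branch e i x).

Lemma branch_index_smul N e i s : junction N e -> (i < N)%nat -> 0 < s ->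
  branch_index N e (smul s (e i)) = i.
Proof.
  intros J Hi Hs. unfold branch_index.
  destruct (epsilon_spec (inhabits 0%nat)
    (fun k => (k < N)%nat /\ on_branch e k (smul s (e i)))) as [Hk [r [Hr Er]]].
  { exists i. split; [auto|]. exists s. split; [lra|auto]. }
  destruct (smul_branch_inj N e i _ s r J Hi Hk Hs Hr Er). auto.
Qed.

Definition quad_test (N : nat) (e : nat -> pt) (c b K : R) (p k : nat -> R)
    (t : R) (x : pt) : R :=
  c + b * t + K * t ^ 2 + p (branch_index N e x) * norm2 x
  + k (branch_index N e x) * norm2 x ^ 2.

Lemma quad_test_branch N e c b K p k i t s : junction N e -> (i < N)%nat -> 0 <= s ->
  quad_test N e c b K p k t (smul s (e i))
  = c + b * t + K * t ^ 2 + p i * s + k i * s ^ 2.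
Proof.
  intros J Hi Hs. unfold quad_test. rewrite (norm2_branch N e i s J Hi Hs).
  destruct (Rle_lt_or_eq_dec 0 s Hs) as [Ps|<-].
  - rewrite branch_index_smul; auto.
  - ring.
Qed.

Lemma quad_continuous (c b K p k t s eps : R) : 0 < eps -> exists del, 0 < del /\
  forall t' s', Rabs (t' - t) < del -> Rabs (s' - s) < del ->
  Rabs (c + b * t' + K * t' ^ 2 + p * s' + k * s' ^ 2
        - (c + b * t + K * t ^ 2 + p * s + k * s ^ 2)) < eps.
Proof.
  intros He.
  set (B := Rabs (b + 2 * K * t) + Rabs K + Rabs (p + 2 * k * s) + Rabs k + 1).
  assert (HB : 1 <= B).
  { unfold B. pose proof (Rabs_pos (b + 2 * K * t)). pose proof (Rabs_pos K).
    pose proof (Rabs_pos (p + 2 * k * s)). pose proof (Rabs_pos k). lra. }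
  exists (Rmin 1 (eps / B)).
  assert (Hr : 0 < eps / B) by (apply Rdiv_lt_0_compat; lra).
  assert (HeB : eps / B * B = eps) by (field; lra).
  set (r := eps / B) in *.
  split; [apply Rmin_glb_lt; lra|]. intros t' s' Ht Hs.
  pose proof (Rmin_l 1 r). pose proof (Rmin_r 1 r).
  set (h := t' - t) in *. set (g := s' - s) in *.
  replace (_ - _) with ((b + 2 * K * t) * h + K * h * h
    + ((p + 2 * k * s) * g + k * g * g)) by (unfold h, g; ring).
  assert (Hm : forall A D x, Rabs x < Rmin 1 r ->
    Rabs (A * x + D * x * x) <= (Rabs A + Rabs D) * r).
  { intros A D x Hx. eapply Rle_trans; [apply Rabs_triang|].
    rewrite !Rabs_mult. pose proof (Rabs_pos A). pose proof (Rabs_pos D).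
    pose proof (Rabs_pos x).
    assert (Rabs A * Rabs x <= Rabs A * r) by (apply Rmult_le_compat_l; lra).
    assert (Rabs D * Rabs x * Rabs x <= Rabs D * r); [|lra].
    rewrite Rmult_assoc. apply Rmult_le_compat_l; [lra|]. nra. }
  eapply Rle_lt_trans; [apply Rabs_triang|].
  pose proof (Hm (b + 2 * K * t) K h Ht). pose proof (Hm (p + 2 * k * s) k g Hs).
  unfold B in HeB. nra.
Qed.

Lemma quad_test_C1star N e T c b K p k : junction N e ->
  C1star N e T (quad_test N e c b K p k) (fun t _ => b + 2 * K * t)
    (fun i _ s => p i + 2 * k i * s).
Proof.
  intros J. split.
  - intros t x _ (i & Hi & s & Hs & ->) eps He.
    destruct (fin_radius N (fun j d => forall t' s',
        Rabs (t' - t) < d -> Rabs (s' - s) < d ->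
        Rabs (c + b * t' + K * t' ^ 2 + p j * s' + k j * s' ^ 2
          - (c + b * t + K * t ^ 2 + p j * s + k j * s ^ 2)) < eps)) as [d [Hd Hq]].
    { intros j d d' Hj Hle t' s' Ht Hs'. apply Hj; lra. }
    { intros j Hj. now apply quad_continuous. }
    (* Off the vertex the radius stays below [s], so that the ball meets no other branch; at the
       vertex one radius serves all branches. *)
    exists (if Rlt_dec 0 s then Rmin d s else d). split.
    { destruct (Rlt_dec 0 s); [apply Rmin_glb_lt|]; lra. }
    intros t' y _ (j & Hj & s' & Hs' & ->) Ht Hdist.
    rewrite !quad_test_branch by auto.
    destruct (Nat.eq_dec i j) as [<-|Hne].
    + rewrite dJ_same, Rabs_minus_sym in Hdist by auto.
      pose proof (Rmin_l d s). apply Hq; auto; destruct (Rlt_dec 0 s); lra.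
    + rewrite dJ_diff in Hdist by auto. pose proof (Rmin_r d s).
      destruct (Rlt_dec 0 s) as [Ps|Ps]; [lra|]. assert (s = 0) by lra. subst s.
      replace (c + b * t + K * t ^ 2 + p i * 0 + k i * 0 ^ 2)
        with (c + b * t + K * t ^ 2 + p j * 0 + k j * 0 ^ 2) by ring.
      apply Hq; auto. rewrite Rminus_0_r, Rabs_pos_eq; lra.
  - intros i Hi. split; [|split].
    + intros t s _ Hs eps He.
      set (B := Rabs K + Rabs (k i) + 1).
      assert (HB : 1 <= B) by (unfold B; pose proof (Rabs_pos K);
        pose proof (Rabs_pos (k i)); lra).
      exists (eps / B). split; [apply Rdiv_lt_0_compat; lra|].
      intros t' s' _ Hs' Ht Hss. rewrite !quad_test_branch by auto.
      assert (HeB : eps / B * B = eps) by (field; lra).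
      assert (Hr : 0 < eps / B) by (apply Rdiv_lt_0_compat; lra).
      set (r := eps / B) in *. set (h := t' - t) in *. set (g := s' - s) in *.
      replace (_ - _ - _ - _) with (K * h * h + k i * g * g) by (unfold h, g; ring).
      eapply Rle_trans; [apply Rabs_triang|]. rewrite !Rabs_mult.
      pose proof (Rabs_pos K). pose proof (Rabs_pos (k i)).
      pose proof (Rabs_pos h). pose proof (Rabs_pos g).
      assert (Rabs K * Rabs h <= eps) by (unfold B in HeB; nra).
      assert (Rabs (k i) * Rabs g <= eps) by (unfold B in HeB; nra). nra.
    + intros t s _ Hs eps He.
      destruct (quad_continuous b (2 * K) 0 0 0 t 0 eps He) as [d [Hd Hq]].
      exists d. split; [auto|]. intros t' s' _ _ Ht _.
      replace (b + 2 * K * t' - (b + 2 * K * t)) with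
        (b + 2 * K * t' + 0 * t' ^ 2 + 0 * 0 + 0 * 0 ^ 2
         - (b + 2 * K * t + 0 * t ^ 2 + 0 * 0 + 0 * 0 ^ 2)) by ring.
      apply Hq; auto. rewrite Rminus_0_r, Rabs_R0. lra.
    + intros t s _ Hs eps He.
      destruct (quad_continuous (p i) (2 * k i) 0 0 0 s 0 eps He) as [d [Hd Hq]].
      exists d. split; [auto|]. intros t' s' _ _ _ Hss.
      replace (p i + 2 * k i * s' - (p i + 2 * k i * s)) with
        (p i + 2 * k i * s' + 0 * s' ^ 2 + 0 * 0 + 0 * 0 ^ 2
         - (p i + 2 * k i * s + 0 * s ^ 2 + 0 * 0 + 0 * 0 ^ 2)) by ring.
      apply Hq; auto. rewrite Rminus_0_r, Rabs_R0. lra.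
Qed.

(** * Suprema defining the Hamiltonians *)

Lemma supR_is_lub (P : R -> Prop) : (exists y, P y) -> (exists m, forall y, P y -> y <= m) ->
  is_lub P (supR P).
Proof.
  intros Hne [m Hm]. unfold supR. apply epsilon_spec.
  destruct (completeness P) as [l Hl]; [exists m; exact Hm|exact Hne|]. now exists l.
Qed.

(** The bound [m] makes the supremum finite; otherwise [supR] would be an arbitrary value. *)
Lemma Ham_ge L i p q m : (forall r, p * r - L i r <= m) -> p * q - L i q <= Ham L i p.
Proof.
  intros H. apply (supR_is_lub (fun y => exists r, y = p * r - L i r)).
  - now exists (p * q - L i q), q.
  - exists m. intros y [r ->]. auto.
  - now exists q.
Qed.

Lemma Ham_le L i p m : (forall r, p * r - L i r <= m) -> Ham L i p <= m.
Proof.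
  intros H. apply (supR_is_lub (fun y => exists r, y = p * r - L i r)).
  - now exists (p * 0 - L i 0), 0.
  - exists m. intros y [r ->]. auto.
  - intros y [r ->]. auto.
Qed.

Lemma HamMinus_ge L i p q m : (forall r, p * r - L i r <= m) -> q <= 0 ->
  p * q - L i q <= HamMinus L i p.
Proof.
  intros H Hq. apply (supR_is_lub (fun y => exists r, r <= 0 /\ y = p * r - L i r)).
  - exists (p * q - L i q), q. auto.
  - exists m. intros y [r [_ ->]]. auto.
  - now exists q.
Qed.

Lemma HamMinus_le L i p m : (forall r, r <= 0 -> p * r - L i r <= m) ->
  HamMinus L i p <= m.
Proof.
  intros H. apply (supR_is_lub (fun y => exists r, r <= 0 /\ y = p * r - L i r)).
  - exists (p * 0 - L i 0), 0. split; [lra|auto].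
  - exists m. intros y [r [Hr ->]]. auto.
  - intros y [r [Hr ->]]. auto.
Qed.

Lemma fold_Rmax_ge (a y : R) (l : list R) : In y l -> y <= fold_right Rmax a l.
Proof.
  induction l as [|x l IH]; intros []; cbn.
  - subst. apply Rmax_l.
  - eapply Rle_trans; [now apply IH|apply Rmax_r].
Qed.

Lemma fold_Rmax_le (a m : R) (l : list R) : a <= m -> (forall y, In y l -> y <= m) ->
  fold_right Rmax a l <= m.
Proof.
  intros Ha. induction l as [|x l IH]; intros H; cbn; [auto|].
  apply Rmax_lub; [apply H; now left|]. apply IH. intros y Hy. apply H. now right.
Qed.

Lemma Hjunc_ge N L p i : (i < N)%nat -> HamMinus L i (p i) <= Hjunc N L p.
Proof.
  intros Hi. apply fold_Rmax_ge.
  apply (in_map (fun i => HamMinus L i (p i))), in_seq. lia.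
Qed.

Lemma Hjunc_le N L p m : (1 <= N)%nat ->
  (forall i, (i < N)%nat -> HamMinus L i (p i) <= m) -> Hjunc N L p <= m.
Proof.
  intros HN H. apply fold_Rmax_le; [apply H; lia|].
  intros y Hy. apply in_map_iff in Hy. destruct Hy as [i [<- Hi]].
  apply in_seq in Hi. apply H. lia.
Qed.

(* Sub- and super-solutions in the coordinates [U i t s = u(t, s e_i)], tested
   only by quadratic polynomials on each branch. *)
Record branch_subsolution (N : nat) (L : nat -> R -> R) (T : R)
    (U : nat -> R -> R -> R) : Prop := {
  bsub_vertex : forall i j t, (i < N)%nat -> (j < N)%nat -> U i t 0 = U j t 0;
  bsub_usc : forall i t s, (i < N)%nat -> 0 <= t < T -> 0 <= s ->
    forall eps, 0 < eps -> exists del, 0 < del /\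
      forall t' s', 0 <= t' < T -> 0 <= s' ->
        Rabs (t' - t) < del -> Rabs (s' - s) < del -> U i t' s' < U i t s + eps;
  bsub_interior_test : forall i t s b p K del, (i < N)%nat -> 0 < t < T -> 0 < s ->
    0 < del ->
    (forall t' s', 0 < t' < T -> 0 <= s' ->
       Rabs (t' - t) < del -> Rabs (s' - s) < del ->
       U i t' s' <= U i t s + b * (t' - t) + p * (s' - s)
                    + K * ((t' - t) ^ 2 + (s' - s) ^ 2)) ->
    forall q, b + p * q - L i q <= 0;
  bsub_vertex_test : forall j0 t b p K del, (j0 < N)%nat -> 0 < t < T -> 0 < del ->
    (forall j t' s', (j < N)%nat -> 0 < t' < T -> 0 <= s' ->
       Rabs (t' - t) < del -> s' < del ->
       U j t' s' <= U j0 t 0 + b * (t' - t) + p j * s'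
                    + K * ((t' - t) ^ 2 + s' ^ 2)) ->
    forall j q, (j < N)%nat -> q <= 0 -> b + p j * q - L j q <= 0 }.

Record branch_supersolution (N : nat) (L : nat -> R -> R) (T : R)
    (V : nat -> R -> R -> R) : Prop := {
  bsup_vertex : forall i j t, (i < N)%nat -> (j < N)%nat -> V i t 0 = V j t 0;
  bsup_lsc : forall i t s, (i < N)%nat -> 0 <= t < T -> 0 <= s ->
    forall eps, 0 < eps -> exists del, 0 < del /\
      forall t' s', 0 <= t' < T -> 0 <= s' ->
        Rabs (t' - t) < del -> Rabs (s' - s) < del -> V i t s - eps < V i t' s';
  bsup_interior_test : forall i t s b p K del m, (i < N)%nat -> 0 < t < T -> 0 < s ->
    0 < del ->
    (forall t' s', 0 < t' < T -> 0 <= s' ->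
       Rabs (t' - t) < del -> Rabs (s' - s) < del ->
       V i t s + b * (t' - t) + p * (s' - s)
       - K * ((t' - t) ^ 2 + (s' - s) ^ 2) <= V i t' s') ->
    (forall q, p * q - L i q <= m) -> 0 <= b + m;
  bsup_vertex_test : forall j0 t b p K k del m, (j0 < N)%nat -> 0 < t < T -> 0 < del ->
    (forall j t' s', (j < N)%nat -> 0 < t' < T -> 0 <= s' ->
       Rabs (t' - t) < del -> s' < del ->
       V j0 t 0 + b * (t' - t) + p j * s' - K * (t' - t) ^ 2 - k j * s' ^ 2
       <= V j t' s') ->
    (forall j q, (j < N)%nat -> q <= 0 -> p j * q - L j q <= m) -> 0 <= b + m }.

Lemma dJ_ball_interior N e i s r y : junction N e -> (i < N)%nat -> 0 < s -> r <= s ->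
  inJ N e y -> dJ N e (smul s (e i)) y < r ->
  exists s', 0 <= s' /\ y = smul s' (e i) /\ Rabs (s' - s) < r.
Proof.
  intros J Hi Hs Hr (j & Hj & s' & Hs' & ->) Hd.
  destruct (Nat.eq_dec i j) as [<-|Hne].
  - rewrite dJ_same, Rabs_minus_sym in Hd by (auto; lra). eauto.
  - rewrite dJ_diff in Hd by (auto; lra). lra.
Qed.

Lemma dJ_ball_vertex N e r y : junction N e -> inJ N e y -> dJ N e origin y < r ->
  exists j s', (j < N)%nat /\ 0 <= s' < r /\ y = smul s' (e j).
Proof.
  intros J (j & Hj & s' & Hs' & ->) Hd.
  rewrite <- (smul_0 (e j)), dJ_same, Rabs_minus_sym, Rminus_0_r, Rabs_pos_eq in Hd
    by (auto; lra).
  exists j, s'. repeat split; auto.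
Qed.

Definition single (i : nat) (a : R) (j : nat) : R := if Nat.eqb j i then a else 0.

Lemma single_eq i a : single i a i = a.
Proof. unfold single. now rewrite Nat.eqb_refl. Qed.

Lemma subsolution_branch N e L T u : junction N e ->
  (forall i p, (i < N)%nat -> exists m, forall q, p * q - L i q <= m) ->
  subsolution N e L T u -> branch_subsolution N L T (fun i t s => u t (smul s (e i))).
Proof.
  intros J HL [Husc Hu]. pose proof J as (HN & _). split.
  - intros i j t _ _. now rewrite !smul_0.
  - intros i t s Hi Ht Hs eps He.
    destruct (Husc t (smul s (e i)) Ht (inJ_branch N e i s Hi Hs) eps He)
      as [d [Hd H]].
    exists d. split; [auto|]. intros t' s' Ht' Hs' H1 H2.
    apply H; auto; [now apply inJ_branch|]. now rewrite dJ_same, Rabs_minus_sym.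
  - intros i t s b p K del Hi Ht Hs Hdel Htest q.
    (* The touching polynomial expanded at 0: the shifts by [2 * K * t] and [2 * K * s] make its
       derivatives at [(t, s)] equal to [b] and [p]. On the other branches [single] puts 0, as the
       ball of radius [Rmin del s] does not meet them. *)
    set (c := u t (smul s (e i)) - b * t + K * t ^ 2 - p * s + K * s ^ 2).
    destruct (Hu _ _ _ (quad_test_C1star N e T c (b - 2 * K * t) K
        (single i (p - 2 * K * s)) (single i K) J)
      t (smul s (e i)) (Rmin del s) Ht) as [H _].
    + apply inJ_branch; auto; lra.
    + apply Rmin_glb_lt; lra.
    + intros t' y Ht' Hy H1 H2.
      destruct (dJ_ball_interior N e i s _ y J Hi Hs (Rmin_r del s) Hy H2)
        as (s' & Hs' & -> & Hss).
      pose proof (Rmin_l del s).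
      rewrite quad_test_branch, !single_eq by auto.
      eapply Rle_trans; [apply Htest; auto; lra|]. unfold c. apply Req_le. ring.
    + rewrite quad_test_branch, !single_eq by (auto; lra). unfold c. ring.
    + specialize (H i s Hi Hs eq_refl). rewrite !single_eq in H.
      replace (p - 2 * K * s + 2 * K * s) with p in H by ring.
      destruct (HL i p Hi) as [m Hm].
      pose proof (Ham_ge L i p q m Hm). lra.
  - intros j0 t b p K del Hj0 Ht Hdel Htest j q Hj Hq.
    set (c := u t origin - b * t + K * t ^ 2).
    destruct (Hu _ _ _ (quad_test_C1star N e T c (b - 2 * K * t) K p (fun _ => K) J)
      t origin del Ht) as [_ H].
    + rewrite <- (smul_0 (e j)). apply inJ_branch; auto; lra.
    + auto.
    + intros t' y Ht' Hy H1 H2.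
      destruct (dJ_ball_vertex N e _ y J Hy H2) as (i & s' & Hi & Hs' & ->).
      rewrite quad_test_branch by (auto; lra).
      eapply Rle_trans; [apply Htest; auto; lra|]. rewrite smul_0. unfold c.
      apply Req_le. ring.
    + rewrite <- (smul_0 (e j)), quad_test_branch, smul_0 by (auto; lra).
      unfold c. ring.
    + specialize (H eq_refl). cbn beta in H.
      pose proof (Hjunc_ge N L (fun i => p i + 2 * K * 0) j Hj) as Hg. cbn beta in Hg.
      replace (p j + 2 * K * 0) with (p j) in Hg by ring.
      destruct (HL j (p j) Hj) as [m Hm].
      pose proof (HamMinus_ge L j (p j) q m Hm Hq). lra.
Qed.

Lemma supersolution_branch N e L T v : junction N e ->
  supersolution N e L T v ->
  branch_supersolution N L T (fun i t s => v t (smul s (e i))).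
Proof.
  intros J [Hlsc Hv]. pose proof J as (HN & _). split.
  - intros i j t _ _. now rewrite !smul_0.
  - intros i t s Hi Ht Hs eps He.
    destruct (Hlsc t (smul s (e i)) Ht (inJ_branch N e i s Hi Hs) eps He)
      as [d [Hd H]].
    exists d. split; [auto|]. intros t' s' Ht' Hs' H1 H2.
    apply H; auto; [now apply inJ_branch|]. now rewrite dJ_same, Rabs_minus_sym.
  - intros i t s b p K del m Hi Ht Hs Hdel Htest Hm.
    set (c := v t (smul s (e i)) - b * t - K * t ^ 2 - p * s - K * s ^ 2).
    destruct (Hv _ _ _ (quad_test_C1star N e T c (b + 2 * K * t) (- K)
        (single i (p + 2 * K * s)) (single i (- K)) J)
      t (smul s (e i)) (Rmin del s) Ht) as [H _].
    + apply inJ_branch; auto; lra.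
    + apply Rmin_glb_lt; lra.
    + intros t' y Ht' Hy H1 H2.
      destruct (dJ_ball_interior N e i s _ y J Hi Hs (Rmin_r del s) Hy H2)
        as (s' & Hs' & -> & Hss).
      pose proof (Rmin_l del s).
      rewrite quad_test_branch, !single_eq by auto.
      eapply Rle_trans; [|apply Htest; auto; lra]. unfold c. apply Req_le. ring.
    + rewrite quad_test_branch, !single_eq by (auto; lra). unfold c. ring.
    + specialize (H i s Hi Hs eq_refl). rewrite !single_eq in H.
      replace (p + 2 * K * s + 2 * - K * s) with p in H by ring.
      pose proof (Ham_le L i p m Hm). lra.
  - intros j0 t b p K k del m Hj0 Ht Hdel Htest Hm.
    set (c := v t origin - b * t - K * t ^ 2).
    destruct (Hv _ _ _ (quad_test_C1star N e T c (b + 2 * K * t) (- K) p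
        (fun j => - k j) J) t origin del Ht) as [_ H].
    + rewrite <- (smul_0 (e j0)). apply inJ_branch; auto; lra.
    + auto.
    + intros t' y Ht' Hy H1 H2.
      destruct (dJ_ball_vertex N e _ y J Hy H2) as (i & s' & Hi & Hs' & ->).
      rewrite quad_test_branch by (auto; lra).
      eapply Rle_trans; [|apply Htest; auto; lra]. rewrite smul_0. unfold c.
      apply Req_le. ring.
    + rewrite <- (smul_0 (e j0)), quad_test_branch, smul_0 by (auto; lra).
      unfold c. ring.
    + specialize (H eq_refl). cbn beta in H.
      assert (Hjunc N L (fun i => p i + 2 * - k i * 0) <= m); [|lra].
      apply Hjunc_le; [auto|]. intros i Hi.
      replace (p i + 2 * - k i * 0) with (p i) by ring.
      apply HamMinus_le. intros r Hr. auto.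
Qed.

(** * Uniformly convex Lagrangians *)

(** Two applications of the mean value theorem give [l = (c - q) * (r - q)] with [c] between [q] and
    [r]. The sharp factor 1/2 is lost, but sign and size of [l] are controlled. *)
Lemma taylor_remainder (F F1 F2 : R -> R) :
  (forall q, derivable_pt_lim F q (F1 q)) ->
  (forall q, derivable_pt_lim F1 q (F2 q)) ->
  forall q r, exists d l, Rmin q r <= d <= Rmax q r /\ 0 <= l <= (r - q) ^ 2 /\
    F r = F q + F1 q * (r - q) + F2 d * l.
Proof.
  assert (MVT : forall G G1 : R -> R, (forall x, derivable_pt_lim G x (G1 x)) ->
    forall x y, exists c, Rmin x y <= c <= Rmax x y /\ G y - G x = G1 c * (y - x)).
  { intros G G1 HG.
    assert (Hlt : forall x y, x < y ->
      exists c, x <= c <= y /\ G y - G x = G1 c * (y - x)).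
    { intros x y Hxy. destruct (MVT_cor2 G G1 x y Hxy (fun c _ => HG c)) as [c [E Hc]].
      exists c. split; [lra|exact E]. }
    intros x y. destruct (Rtotal_order x y) as [H|[<-|H]].
    - rewrite Rmin_left, Rmax_right by lra. auto.
    - exists x. rewrite Rmin_left, Rmax_left by lra. split; [lra|ring].
    - rewrite Rmin_right, Rmax_left by lra. destruct (Hlt y x H) as [c [Hc E]].
      exists c. split; [exact Hc|]. nra. }
  intros HF HF1 q r.
  destruct (MVT F F1 HF q r) as [c [Hc Ec]]. destruct (MVT F1 F2 HF1 q c) as [d [Hd Ed]].
  exists d, ((c - q) * (r - q)). split; [|split].
  - unfold Rmin, Rmax in *.
    destruct (Rle_dec q r), (Rle_dec q c); lra.
  - unfold Rmin, Rmax in Hc. destruct (Rle_dec q r); nra.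
  - replace (F r) with (F q + (F r - F q)) by ring. rewrite Ec.
    replace (F1 c) with (F1 q + (F1 c - F1 q)) by ring. rewrite Ed. ring.
Qed.

(** The majorants are local since the second derivative has no upper bound; they are what makes
    actions admissible in test functions. *)
Definition uniformly_convex (gamma : R) (F F1 : R -> R) : Prop :=
  0 < gamma /\ continuity F /\ continuity F1 /\
  (forall q r, F q + F1 q * (r - q) + gamma / 2 * (r - q) ^ 2 <= F r) /\
  (forall q, exists M, 0 <= M /\ forall r, Rabs (r - q) <= 1 ->
     F r <= F q + F1 q * (r - q) + M * (r - q) ^ 2).

Lemma C2_uniformly_convex gamma F F1 F2 : 0 < gamma ->
  (forall q, derivable_pt_lim F q (F1 q)) ->
  (forall q, derivable_pt_lim F1 q (F2 q)) ->
  continuity F2 -> (forall q, gamma <= F2 q) -> uniformly_convex gamma F F1.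
Proof.
  intros Hg H1 H2 Hc HF2.
  split; [auto|]. split; [|split; [|split]].
  - intros q. apply derivable_continuous_pt. exists (F1 q). apply H1.
  - intros q. apply derivable_continuous_pt. exists (F2 q). apply H2.
  - intros q r.
    (* Removing [gamma / 2 * x ^ 2] leaves a convex function, whose remainder is nonnegative even
       without the sharp factor; this saves the exact constant [gamma / 2]. *)
    destruct (taylor_remainder (fun x => F x - gamma / 2 * x ^ 2)
       (fun x => F1 x - gamma * x) (fun x => F2 x - gamma)) with (q := q) (r := r)
      as (d & l & _ & Hl & E).
    + intros x. apply derivable_pt_lim_minus; [auto|].
      replace (gamma * x) with (gamma / 2 * (INR 2 * x ^ 1)) by (cbn; field).
      apply (derivable_pt_lim_scal (fun x => x ^ 2)), derivable_pt_lim_pow.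
    + intros x. apply derivable_pt_lim_minus; [auto|].
      replace gamma with (gamma * 1) at 2 by ring.
      apply (derivable_pt_lim_scal id), derivable_pt_lim_id.
    + specialize (HF2 d). nra.
  - intros q.
    destruct (continuity_ab_maj F2 (q - 1) (q + 1) ltac:(lra)) as [x [Hx _]].
    { intros c _. apply Hc. }
    exists (F2 x). split; [specialize (HF2 x); lra|]. intros r Hr.
    destruct (taylor_remainder F F1 F2 H1 H2 q r) as (d & l & Hd & Hl & ->).
    assert (Hdx : F2 d <= F2 x).
    { apply Hx. unfold Rabs in Hr. unfold Rmin, Rmax in Hd.
      destruct (Rcase_abs (r - q)), (Rle_dec q r); lra. }
    pose proof (HF2 d). nra.
Qed.

Lemma uniformly_convex_bounded_conj gamma F F1 p : uniformly_convex gamma F F1 ->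
  exists m, forall q, p * q - F q <= m.
Proof.
  intros (Hg & _ & _ & Hlow & _).
  exists ((p - F1 0) ^ 2 / (2 * gamma) - F 0). intros q. specialize (Hlow 0 q).
  assert (0 <= (gamma * q - (p - F1 0)) ^ 2 / (2 * gamma)).
  { apply Rmult_le_pos; [apply pow2_ge_0|]. left. apply Rinv_0_lt_compat. lra. }
  replace ((gamma * q - (p - F1 0)) ^ 2 / (2 * gamma)) with
    (gamma / 2 * q ^ 2 - (p - F1 0) * q + (p - F1 0) ^ 2 / (2 * gamma)) in H
    by (field; lra).
  nra.
Qed.

(* [tangent_value F F1 q] is minus the Hamiltonian at [p = F1 q]. *)
Definition tangent_value (F F1 : R -> R) (q : R) : R := F q - q * F1 q.

Lemma tangent_value_bound gamma F F1 q : uniformly_convex gamma F F1 ->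
  tangent_value F F1 q + gamma / 2 * q ^ 2 <= F 0.
Proof.
  intros (_ & _ & _ & Hlow & _). specialize (Hlow q 0). unfold tangent_value. nra.
Qed.

(** Intermediate value theorem: [tangent_value] equals [F 0] at 0 and falls quadratically on both
    sides. In terms of the Hamiltonian, every level above its minimum [- F 0] is reached on its
    increasing and on its decreasing part. *)
Lemma tangent_value_onto gamma F F1 y : uniformly_convex gamma F F1 -> y <= F 0 ->
  (exists q, 0 <= q /\ tangent_value F F1 q = y) /\
  (exists q, q <= 0 /\ tangent_value F F1 q = y).
Proof.
  intros HF Hy. pose proof HF as (Hg & HcF & HcF1 & _).
  assert (Hc : forall s, continuity (fun q => y - tangent_value F F1 (s * q))).
  { intros s. assert (Hs : continuity (fun q => s * q)) by
      (apply (continuity_scal id), derivable_continuous, derivable_id).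
    apply continuity_minus; [apply continuity_const; now intros ? ?|].
    apply continuity_minus; [now apply (continuity_comp (fun q => s * q))|].
    apply continuity_mult; [exact Hs|now apply (continuity_comp (fun q => s * q))]. }
  (* With [w = 2 * (F 0 - y) / gamma], [(1 + w) ^ 2 >= w] gives [gamma / 2 * M ^ 2 >= F 0 - y]. *)
  set (M := 1 + 2 * (F 0 - y) / gamma).
  assert (HM : F 0 - gamma / 2 * M ^ 2 <= y).
  { assert (0 <= 2 * (F 0 - y) / gamma) by
      (apply Rmult_le_pos; [lra|left; apply Rinv_0_lt_compat; lra]).
    assert (gamma * (2 * (F 0 - y) / gamma) = 2 * (F 0 - y)) by (field; lra).
    unfold M. set (w := 2 * (F 0 - y) / gamma) in *. nra. }
  assert (HM0 : 0 <= M).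
  { unfold M. assert (0 <= 2 * (F 0 - y) / gamma); [|lra].
    apply Rmult_le_pos; [lra|left; apply Rinv_0_lt_compat; lra]. }
  assert (Hs : forall s, s ^ 2 = 1 -> exists q, 0 <= q /\ tangent_value F F1 (s * q) = y).
  { intros s Es.
    destruct (IVT_cor (fun q => y - tangent_value F F1 (s * q)) 0 M (Hc s) HM0)
      as [q [Hq Eq]].
    - pose proof (tangent_value_bound gamma F F1 (s * M) HF).
      replace ((s * M) ^ 2) with (M ^ 2) in H by (rewrite Rpow_mult_distr, Es; ring).
      rewrite Rmult_0_r. unfold tangent_value at 1.
      assert (y - (F 0 - 0 * F1 0) <= 0) by lra.
      assert (0 <= y - tangent_value F F1 (s * M)) by lra. nra.
    - exists q. split; [lra|]. lra. }
  split.
  - destruct (Hs 1 ltac:(ring)) as [q [Hq E]]. exists q. rewrite Rmult_1_l in E. auto.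
  - destruct (Hs (-1) ltac:(ring)) as [q [Hq E]]. exists (-1 * q). split; [lra|auto].
Qed.

(* The action of a straight path of duration [th] and displacement [z]; for
   [th = 0] it is only used with [z = 0], where its value is [0]. *)
Definition action (F : R -> R) (th z : R) : R := th * F (z / th).

(** The minorant of [F] at [q], read at the mean speed [z / th] and multiplied by [th]. *)
Lemma action_lower gamma F F1 q th z : uniformly_convex gamma F F1 -> 0 < th ->
  th * tangent_value F F1 q + F1 q * z + gamma / 2 * ((z - q * th) ^ 2 / th)
  <= action F th z.
Proof.
  intros (_ & _ & _ & Hlow & _) Hth. specialize (Hlow q (z / th)).
  apply (Rmult_le_compat_l th) in Hlow; [|lra]. unfold action, tangent_value.
  eapply Rle_trans; [|exact Hlow]. apply Req_le. field. lra.
Qed.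

Lemma action_tangent gamma F F1 q th z : uniformly_convex gamma F F1 -> 0 < th ->
  th * tangent_value F F1 q + F1 q * z <= action F th z.
Proof.
  intros HF Hth. pose proof (action_lower gamma F F1 q th z HF Hth).
  assert (0 <= gamma / 2 * ((z - q * th) ^ 2 / th)); [|lra].
  destruct HF as (Hg & _). apply Rmult_le_pos; [lra|].
  apply Rmult_le_pos; [apply pow2_ge_0|left; now apply Rinv_0_lt_compat].
Qed.

Lemma action_eq F F1 th z : 0 < th ->
  action F th z = th * tangent_value F F1 (z / th) + F1 (z / th) * z.
Proof. intros Hth. unfold action, tangent_value. field. lra. Qed.

(** Local semiconcavity, with the tangent plane as affine part: it lets minus an action be replaced
    by a quadratic test function from below. *)
Lemma action_upper gamma F F1 th z : uniformly_convex gamma F F1 -> 0 < th ->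
  exists K d, 0 <= K /\ 0 < d /\ forall th' z', Rabs (th' - th) < d -> Rabs (z' - z) < d ->
    0 < th' /\
    action F th' z' <= th' * tangent_value F F1 (z / th) + F1 (z / th) * z'
      + K * ((th' - th) ^ 2 + (z' - z) ^ 2).
Proof.
  intros (_ & _ & _ & _ & Hup) Hth. set (q := z / th).
  destruct (Hup q) as [M [HM HF]].
  assert (Hz : z = q * th) by (unfold q; field; lra).
  pose proof (Rabs_pos q) as Hq.
  (* The radius ensures [th / 2 < th'] and that [z' / th'] is within 1 of [q], where the majorant of
     [F] holds. The constant combines [2 * (1 + q ^ 2)], from the square of [w], with
     [/ th' <= 2 / th]. *)
  exists (4 * M * (1 + q ^ 2) / th), (Rmin (th / 2) (th / (2 * (1 + Rabs q)))).
  split; [|split].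
  - apply Rmult_le_pos; [|left; now apply Rinv_0_lt_compat]. nra.
  - apply Rmin_glb_lt; [lra|]. apply Rdiv_lt_0_compat; lra.
  - intros th' z' H1 H2.
    pose proof (Rmin_l (th / 2) (th / (2 * (1 + Rabs q)))).
    pose proof (Rmin_r (th / 2) (th / (2 * (1 + Rabs q)))).
    set (d := Rmin _ _) in *. set (d1 := th / (2 * (1 + Rabs q))) in *.
    assert (Hd1 : d1 * (1 + Rabs q) = th / 2) by (unfold d1; field; lra).
    assert (Hth' : th / 2 < th') by (apply Rabs_def2 in H1; lra).
    split; [lra|].
    set (w := z' - q * th').
    assert (Hw : w = (z' - z) - q * (th' - th)) by (unfold w; rewrite Hz; ring).
    assert (Hwabs : Rabs w <= th').
    { rewrite Hw. unfold Rminus at 1. eapply Rle_trans; [apply Rabs_triang|].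
      rewrite Rabs_Ropp, Rabs_mult. nra. }
    assert (Hwsq : w ^ 2 <= 2 * (1 + q ^ 2) * ((th' - th) ^ 2 + (z' - z) ^ 2)).
    { rewrite Hw. set (h := th' - th). set (k := z' - z).
      assert (0 <= (k + q * h) ^ 2) by apply pow2_ge_0.
      pose proof (pow2_ge_0 h). pose proof (pow2_ge_0 (q * k)). nra. }
    assert (Er : z' / th' - q = w / th') by (unfold w; field; lra).
    assert (Hi : 0 < / th') by (apply Rinv_0_lt_compat; lra).
    specialize (HF (z' / th')). rewrite Er in HF.
    assert (Hr : Rabs (w / th') <= 1).
    { unfold Rdiv. rewrite Rabs_mult, (Rabs_pos_eq (/ th')) by lra.
      replace 1 with (th' * / th') by (field; lra).
      apply Rmult_le_compat_r; lra. }
    specialize (HF Hr). apply (Rmult_le_compat_l th') in HF; [|lra].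
    unfold action, tangent_value. eapply Rle_trans; [exact HF|].
    replace (th' * (F q + F1 q * (w / th') + M * (w / th') ^ 2)) with
      (th' * (F q - q * F1 q) + F1 q * z' + M * w ^ 2 * / th')
      by (unfold w; field; lra).
    apply Rplus_le_compat_l.
    assert (Hinv : / th' <= 2 / th).
    { replace (2 / th) with (/ (th / 2)) by (field; lra). apply Rinv_le_contravar; lra. }
    assert (0 <= M * w ^ 2) by (apply Rmult_le_pos; [auto|apply pow2_ge_0]).
    apply Rle_trans with (M * w ^ 2 * (2 / th)); [now apply Rmult_le_compat_l|].
    apply Rle_trans with (M * (2 * (1 + q ^ 2) * ((th' - th) ^ 2 + (z' - z) ^ 2))
      * (2 / th)).
    + apply Rmult_le_compat_r; [left; apply Rdiv_lt_0_compat; lra|].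
      now apply Rmult_le_compat_l.
    + apply Req_le. field. lra.
Qed.

(** This and the next bound concern the barrier [lam / (t2 - t)], with [x = t2 - t] and [h] the time
    increment. *)
Lemma inv_tangent (lam x h : R) : 0 <= lam -> 0 < x -> 0 < x - h ->
  lam / x + lam / x ^ 2 * h <= lam / (x - h).
Proof.
  intros Hl Hx Hxh.
  replace (lam / (x - h)) with (lam / x + lam / x ^ 2 * h + lam * h ^ 2 / (x ^ 2 * (x - h)))
    by (field; lra).
  assert (0 <= lam * h ^ 2 / (x ^ 2 * (x - h))); [|lra].
  apply Rmult_le_pos; [apply Rmult_le_pos; [lra|apply pow2_ge_0]|].
  left. apply Rinv_0_lt_compat. apply Rmult_lt_0_compat; [apply pow_lt|]; lra.
Qed.

Lemma inv_upper (lam x h : R) : 0 <= lam -> 0 < x -> Rabs h < x / 2 ->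
  lam / (x - h) <= lam / x + lam / x ^ 2 * h + 2 * lam / x ^ 3 * h ^ 2.
Proof.
  intros Hl Hx Hh. apply Rabs_def2 in Hh.
  replace (lam / (x - h)) with (lam / x + lam / x ^ 2 * h + lam * h ^ 2 / x ^ 2 * / (x - h))
    by (field; lra).
  apply Rplus_le_compat_l.
  replace (2 * lam / x ^ 3 * h ^ 2) with (lam * h ^ 2 / x ^ 2 * / (x / 2))
    by (field; lra).
  apply Rmult_le_compat_l.
  - apply Rmult_le_pos; [apply Rmult_le_pos; [lra|apply pow2_ge_0]|].
    left. apply Rinv_0_lt_compat, pow_lt. lra.
  - apply Rinv_le_contravar; lra.
Qed.

Lemma inv_bounded_gap (lam x B : R) : 0 < lam -> 0 < x -> 0 < B -> lam / x <= B ->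
  lam / B <= x.
Proof.
  intros Hl Hx HB H. apply (Rmult_le_reg_r B); [auto|].
  replace (lam / B * B) with lam by (field; lra).
  apply (Rmult_le_compat_r x) in H; [|lra].
  replace (lam / x * x) with lam in H by (field; lra). lra.
Qed.

Lemma quadratic_lower (E w y : R) : 0 < E -> - (w ^ 2 / (4 * E)) <= E * y ^ 2 - w * y.
Proof.
  intros HE. assert (0 <= (2 * E * y - w) ^ 2 / (4 * E)).
  { apply Rmult_le_pos; [apply pow2_ge_0|left; apply Rinv_0_lt_compat; lra]. }
  replace ((2 * E * y - w) ^ 2 / (4 * E)) with
    (E * y ^ 2 - w * y + w ^ 2 / (4 * E)) in H by (field; lra). lra.
Qed.

(** * Suboptimality of sub-solutions *)

(** Below a given value [y] is bounded and the barrier keeps [x] at distance [lam / B] from [t2], so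
    the minimisation takes place in a box. *)
Lemma coercive_attains_min (Dom : R -> R -> R -> Prop) (f : R -> R -> R -> R)
    (x0 y0 z0 lam Q t0 t2 a3 b3 : R) :
  0 < lam -> Dom x0 y0 z0 ->
  (forall x y z, Dom x y z -> t0 <= x < t2 /\ 0 <= y /\ a3 <= z <= b3 /\
     y - Q + lam / (t2 - x) <= f x y z) ->
  (forall x y z m, t0 <= x < t2 -> 0 <= y -> a3 <= z <= b3 ->
     (Dom x y z -> m < f x y z) ->
     exists d, 0 < d /\ forall x' y' z', Dom x' y' z' ->
       Rabs (x' - x) < d -> Rabs (y' - y) < d -> Rabs (z' - z) < d ->
       m < f x' y' z') ->
  exists x y z, Dom x y z /\
    forall x' y' z', Dom x' y' z' -> f x y z <= f x' y' z'.
Proof.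
  intros Hlam D0 Hcoer Hlsc.
  set (B := Rabs (f x0 y0 z0 + Q) + 1).
  assert (HB : 0 < B) by (unfold B; pose proof (Rabs_pos (f x0 y0 z0 + Q)); lra).
  assert (Hgap : 0 < lam / B) by now apply Rdiv_lt_0_compat.
  apply (lsc_attains_min Dom f x0 y0 z0 t0 (t2 - lam / B) 0 B a3 b3); auto.
  - intros x y z D Hle. destruct (Hcoer x y z D) as (Hx & Hy & Hz & Hf).
    assert (Hp : 0 < lam / (t2 - x)) by (apply Rdiv_lt_0_compat; lra).
    pose proof (Rle_abs (f x0 y0 z0 + Q)).
    assert (lam / B <= t2 - x).
    { apply inv_bounded_gap; auto; [lra|]. unfold B. lra. }
    unfold B in *. repeat split; lra.
  - intros x y z m Hx Hy Hz. apply Hlsc; lra.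
Qed.

(** If the action were exceeded, [Phi] would have a minimum at a time [r > t], and testing there at
    the speed [q] of the path leaves only the barrier slope [lam / x ^ 2 > 0]. Outward speeds cannot
    be tested at the vertex, so for [0 < q] the minimum is kept off it, which uses [0 < s]. *)
Lemma suboptimality_off_vertex N L T U C i t t' s s' :
  branch_subsolution N L T U -> 0 <= C ->
  (forall j r y, (j < N)%nat -> 0 <= r < T -> 0 <= y -> U j r y <= C * (1 + y)) ->
  (i < N)%nat -> 0 <= t < t' -> t' < T -> 0 <= s -> 0 <= s' -> (s' <= s \/ 0 < s) ->
  U i t' s' <= U i t s + action (L i) (t' - t) (s' - s).
Proof.
  intros HU HC Hgrow Hi Ht Ht' Hs Hs' Hss.
  pose proof HU as [Hvert Husc Hint Hver].
  set (q := (s' - s) / (t' - t)). set (l := L i q). unfold action. fold q. fold l.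
  apply Rnot_lt_le. intros Hcontra.
  set (kap := U i t' s' - (U i t s + (t' - t) * l)).
  assert (Hkap : 0 < kap) by (unfold kap; lra).
  (* The barrier at [t'] is then [kap / 2], half of the excess. *)
  set (t2 := (t' + T) / 2). set (lam := kap / 2 * (t2 - t')).
  assert (Ht2 : t' < t2 < T) by (unfold t2; lra).
  assert (Hlam : 0 < lam) by (unfold lam; apply Rmult_lt_0_compat; lra).
  set (X := fun r => s + q * (r - t)).
  assert (HXt' : X t' = s') by (unfold X, q; field; lra).
  set (B0 := s + Rabs q * T).
  assert (HX : forall r, t <= r < t2 -> Rabs (X r) <= B0).
  { intros r Hr. unfold X, B0. eapply Rle_trans; [apply Rabs_triang|].
    rewrite (Rabs_pos_eq s), Rabs_mult, (Rabs_pos_eq (r - t)) by lra.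
    pose proof (Rabs_pos q). nra. }
  (* [E] serves twice: it controls [U] around the path at time [t], and for [0 < s] it makes the
     vertex too expensive. *)
  assert (HE : exists E, 0 < E /\
     (forall y, 0 <= y -> U i t y - E * (y - s) ^ 2 <= U i t s + kap / 2) /\
     (0 < s -> C - U i t s + T * Rabs l <= E * s ^ 2)).
  { destruct (Husc i t s Hi ltac:(lra) Hs (kap / 2) ltac:(lra)) as [d [Hd Hd']].
    set (D := Rabs (C * (1 + s) - U i t s)).
    (* Within [d] of [s] semicontinuity suffices; beyond, these terms make the quadratic exceed the
       linear growth. *)
    set (E1 := C / d + D / d ^ 2 + 1).
    set (E2 := if Rlt_dec 0 s then Rabs (C - U i t s + T * Rabs l) / s ^ 2 else 0).
    assert (HC' : 0 <= C / d) by
      (apply Rmult_le_pos; [auto|left; now apply Rinv_0_lt_compat]).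
    assert (HD' : 0 <= D / d ^ 2) by (apply Rmult_le_pos;
      [apply Rabs_pos|left; apply Rinv_0_lt_compat; now apply pow_lt]).
    assert (HE2 : 0 <= E2).
    { unfold E2. destruct (Rlt_dec 0 s); [|lra]. apply Rmult_le_pos; [apply Rabs_pos|].
      left. apply Rinv_0_lt_compat. now apply pow_lt. }
    exists (E1 + E2). split; [unfold E1; lra|]. split.
    - intros y Hy. destruct (Rlt_dec (Rabs (y - s)) d) as [Hlt|Hge].
      + specialize (Hd' t y ltac:(lra) Hy). rewrite Rminus_diag, Rabs_R0 in Hd'.
        specialize (Hd' Hd Hlt). pose proof (pow2_ge_0 (y - s)). unfold E1. nra.
      + pose proof (Hgrow i t y Hi ltac:(lra) Hy) as Hg.
        pose proof (Rle_abs (y - s)). pose proof (Rle_abs (C * (1 + s) - U i t s)) as HD.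
        fold D in HD. rewrite <- (pow2_abs (y - s)).
        set (w := Rabs (y - s)) in *.
        assert (HCd : C / d * d = C) by (field; lra).
        assert (HDd : D / d ^ 2 * d ^ 2 = D) by (field; lra).
        assert (C * w <= C / d * w ^ 2).
        { rewrite <- HCd at 1. rewrite Rmult_assoc. apply Rmult_le_compat_l; nra. }
        assert (D <= D / d ^ 2 * w ^ 2).
        { rewrite <- HDd at 1. apply Rmult_le_compat_l; [auto|]. nra. }
        pose proof (pow2_ge_0 w). unfold E1. nra.
    - intros Ps. unfold E2. destruct (Rlt_dec 0 s); [|lra].
      pose proof (Rle_abs (C - U i t s + T * Rabs l)).
      set (D2 := Rabs (C - U i t s + T * Rabs l)) in *.
      assert (D2 / s ^ 2 * s ^ 2 = D2) by (field; lra).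
      assert (0 <= E1 * s ^ 2) by
        (apply Rmult_le_pos; [unfold E1; lra|apply pow2_ge_0]). lra. }
  destruct HE as (E & HE & HE1 & HE2).
  (* The slope on the other branches has to beat the growth, to contradict the test at speed 1
     there, and to control [U] at time [t]. *)
  assert (HP : exists P, forall j, (j < N)%nat -> C + 1 <= P /\
     L j 1 - l + 2 * E * Rabs q * B0 < P /\
     forall y, 0 <= y -> U j t y - E * s ^ 2 - P * y <= U i t s + kap / 2).
  { apply fin_bound.
    - intros j c c' (H1 & H2 & H3) Hcc. split; [lra|]. split; [lra|].
      intros y Hy. specialize (H3 y Hy). nra.
    - intros j Hj.
      assert (H3 : exists P, forall y, 0 <= y ->
        U j t y - E * s ^ 2 - P * y <= U i t s + kap / 2).
      { destruct (Rle_lt_or_eq_dec 0 s Hs) as [Ps|E0].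
        - exists C. intros y Hy. pose proof (Hgrow j t y Hj ltac:(lra) Hy).
          specialize (HE2 Ps). pose proof (Rabs_pos l).
          assert (0 <= T * Rabs l) by (apply Rmult_le_pos; lra). lra.
        - destruct (Husc j t 0 Hj ltac:(lra) ltac:(lra) (kap / 2) ltac:(lra))
            as [d [Hd Hd']].
          rewrite (Hvert j i t Hj Hi) in Hd'. rewrite <- E0.
          set (D := Rabs (C - U i t 0)).
          exists (C + D / d). intros y Hy.
          assert (HDd : D / d * d = D) by (field; lra).
          assert (0 <= D / d) by (apply Rmult_le_pos;
            [apply Rabs_pos|left; now apply Rinv_0_lt_compat]).
          destruct (Rlt_dec y d) as [Hlt|Hge].
          + specialize (Hd' t y ltac:(lra) Hy). rewrite Rminus_diag, Rabs_R0 in Hd'.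
            rewrite Rminus_0_r, Rabs_pos_eq in Hd' by lra.
            specialize (Hd' Hd Hlt). nra.
          + pose proof (Hgrow j t y Hj ltac:(lra) Hy) as Hg.
            pose proof (Rle_abs (C - U i t 0)) as HD. fold D in HD.
            assert (D <= D / d * y) by (rewrite <- HDd at 1; apply Rmult_le_compat_l; lra).
            nra. }
      destruct H3 as [P0 H3].
      set (P := Rmax P0 (Rmax (C + 1) (L j 1 - l + 2 * E * Rabs q * B0 + 1))).
      assert (P0 <= P) by apply Rmax_l.
      assert (Rmax (C + 1) (L j 1 - l + 2 * E * Rabs q * B0 + 1) <= P) by apply Rmax_r.
      pose proof (Rmax_l (C + 1) (L j 1 - l + 2 * E * Rabs q * B0 + 1)).
      pose proof (Rmax_r (C + 1) (L j 1 - l + 2 * E * Rabs q * B0 + 1)).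
      exists P. split; [lra|]. split; [lra|]. intros y Hy. specialize (H3 y Hy). nra. }
  destruct HP as [P HP].
  (* Both formulas agree at the vertex. [X] follows the line of the path beyond [t'] too, where it
     may be negative. *)
  set (pen := fun (j : nat) r y =>
    if Nat.eq_dec j i then E * (y - X r) ^ 2 else E * X r ^ 2 + P * y).
  set (pr := fun (j : nat) r y =>
    if Nat.eq_dec j i then - 2 * E * q * (y - X r) else 2 * E * q * X r).
  set (py := fun (j : nat) r y =>
    if Nat.eq_dec j i then 2 * E * (y - X r) else P).
  set (K := 2 * E * (1 + q ^ 2)).
  assert (Hpen : forall j r y r' y',
    pen j r y + pr j r y * (r' - r) + py j r y * (y' - y) <= pen j r' y'
    <= pen j r y + pr j r y * (r' - r) + py j r y * (y' - y)
       + K * ((r' - r) ^ 2 + (y' - y) ^ 2)).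
  { intros j r y r' y'. unfold pen, pr, py.
    assert (EX : X r' = X r + q * (r' - r)) by (unfold X; ring). rewrite EX.
    set (h := r' - r). replace y' with (y + (y' - y)) by ring. set (k := y' - y).
    replace (y + k - y) with k by ring. unfold K.
    assert (0 <= E * (k - q * h) ^ 2) by (apply Rmult_le_pos; [lra|apply pow2_ge_0]).
    assert (0 <= E * (k + q * h) ^ 2) by (apply Rmult_le_pos; [lra|apply pow2_ge_0]).
    assert (0 <= E * (q * h) ^ 2) by (apply Rmult_le_pos; [lra|apply pow2_ge_0]).
    assert (0 <= E * (q * k) ^ 2) by (apply Rmult_le_pos; [lra|apply pow2_ge_0]).
    assert (0 <= E * h ^ 2) by (apply Rmult_le_pos; [lra|apply pow2_ge_0]).
    assert (0 <= E * k ^ 2) by (apply Rmult_le_pos; [lra|apply pow2_ge_0]).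
    destruct (Nat.eq_dec j i); nra. }
  set (Phi := fun j r y => - U j r y + (r * l + pen j r y + lam / (t2 - r))).
  set (Dom := fun r y z : R => t <= r < t2 /\ 0 <= y /\ z = 0).
  assert (Hcoer : exists Q, forall j r y, (j < N)%nat -> t <= r < t2 -> 0 <= y ->
     y - Q + lam / (t2 - r) <= Phi j r y).
  { set (w := 2 * E * B0 + C + 1).
    pose proof (fun y => quadratic_lower E w y HE) as Hw.
    assert (0 <= w ^ 2 / (4 * E)).
    { apply Rmult_le_pos; [apply pow2_ge_0|left; apply Rinv_0_lt_compat; lra]. }
    exists (C + T * Rabs l + w ^ 2 / (4 * E)). intros j r y Hj Hr Hy. unfold Phi.
    pose proof (Hgrow j r y Hj ltac:(lra) Hy) as Hg.
    assert (- (T * Rabs l) <= r * l).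
    { pose proof (Rle_abs (- l)) as Hl. rewrite Rabs_Ropp in Hl.
      pose proof (Rabs_pos l). nra. }
    assert ((C + 1) * y - w ^ 2 / (4 * E) <= pen j r y); [|lra].
    unfold pen. destruct (Nat.eq_dec j i).
    - pose proof (Rle_abs (X r)). pose proof (HX r Hr). pose proof (pow2_ge_0 (X r)).
      specialize (Hw y). unfold w in Hw at 2.
      assert (E * (y ^ 2 - 2 * B0 * y) <= E * (y - X r) ^ 2)
        by (apply Rmult_le_compat_l; nra). nra.
    - destruct (HP j Hj) as (H1 & _). pose proof (pow2_ge_0 (X r)). nra. }
  destruct Hcoer as [Q Hcoer].
  destruct (fin_family_min (R * R) (fun _ a => t <= fst a < t2 /\ 0 <= snd a)
     (fun j a => Phi j (fst a) (snd a)) N ltac:(lia)) as (j & [r y] & Hj & Da & Hmin).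
  { intros j Hj.
    destruct (coercive_attains_min Dom (fun r y _ => Phi j r y) t 0 0 lam Q t t2 0 0)
      as (r & y & z & (Hr & Hy & _) & Hm); auto.
    - unfold Dom. repeat split; lra.
    - intros r y z (Hr & Hy & ->). repeat split; try lra. now apply Hcoer.
    - intros r y z m Hr Hy Hz Hm.
      assert (Hm' : m < - U j r y + (r * l + pen j r y + lam / (t2 - r)))
        by (apply Hm; unfold Dom; repeat split; lra).
      destruct (lsc_plus_affine (fun r y => - U j r y) (fun r y => 0 <= r < T /\ 0 <= y)
        r y z (r * l + pen j r y + lam / (t2 - r)) (l + pr j r y + lam / (t2 - r) ^ 2) (py j r y) 0 m) with (2 := Hm')
        as [d [Hd Hdd]].
      { intros eps He. destruct (Husc j r y Hj ltac:(lra) Hy eps He) as [d [Hd Hu]].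
        exists d. split; [auto|]. intros r' y' [Hr' Hy'] H1 H2.
        specialize (Hu r' y' Hr' Hy' H1 H2). lra. }
      exists d. split; [auto|]. intros r' y' z' (Hr' & Hy' & _) H1 H2 H3.
      eapply Rlt_le_trans; [apply (Hdd r' y' z'); auto; lra|]. unfold Phi.
      pose proof (Hpen j r y r' y') as [Hp _].
      pose proof (inv_tangent lam (t2 - r) (r' - r) ltac:(lra) ltac:(lra) ltac:(lra)) as Hinv.
      replace (t2 - r - (r' - r)) with (t2 - r') in Hinv by ring. lra.
    - exists (r, y). cbn. split; [auto|]. intros [r' y'] [Hr' Hy']. cbn in *.
      apply (Hm r' y' 0). unfold Dom. auto. }
  cbn in Da, Hmin. destruct Da as [Hr Hy].
  (* Comparison with the endpoint [(t', s')]; by the choice of [E] and [P] no point at time [t] has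
     so low a value. *)
  assert (Hlow : Phi j r y < - U i t s + t * l - kap / 2 + lam / (t2 - t)).
  { eapply Rle_lt_trans; [apply (Hmin i (t', s') Hi); cbn; lra|]. cbn. unfold Phi, pen.
    destruct (Nat.eq_dec i i); [|easy]. rewrite HXt', Rminus_diag.
    replace (lam / (t2 - t')) with (kap / 2) by (unfold lam; field; lra).
    assert (0 < lam / (t2 - t)) by (apply Rdiv_lt_0_compat; lra).
    unfold kap at 1. unfold kap in *. lra. }
  destruct (Rle_lt_or_eq_dec t r (proj1 Hr)) as [Htr|<-].
  2:{ unfold Phi, pen in Hlow.
      assert (EX : X t = s) by (unfold X; ring). rewrite EX in Hlow.
      destruct (Nat.eq_dec j i) as [->|_].
      - specialize (HE1 y Hy). lra.
      - destruct (HP j Hj) as (_ & _ & H3). specialize (H3 y Hy). lra. }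
  set (x := t2 - r). assert (Hx : 0 < x) by (unfold x; lra).
  set (b := l + pr j r y + lam / x ^ 2).
  assert (Hlx : 0 < lam / x ^ 2) by (apply Rdiv_lt_0_compat; [auto|now apply pow_lt]).
  set (d := Rmin (r - t) (x / 2)).
  assert (Hd : 0 < d) by (apply Rmin_glb_lt; lra).
  set (K2 := K + 2 * lam / x ^ 3).
  assert (Htouch : forall j' r' y', (j' < N)%nat -> 0 <= y' -> Rabs (r' - r) < d ->
    U j' r' y' <= U j r y + (l + lam / x ^ 2) * (r' - r) + (pen j' r' y' - pen j r y)
      + 2 * lam / x ^ 3 * (r' - r) ^ 2).
  { intros j' r' y' Hj' Hy' Hr'. unfold d in Hr'.
    pose proof (Rmin_l (r - t) (x / 2)). pose proof (Rmin_r (r - t) (x / 2)).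
    pose proof (inv_upper lam x (r' - r) ltac:(lra) Hx ltac:(lra)) as Hinv.
    apply Rabs_def2 in Hr'.
    specialize (Hmin j' (r', y') Hj'). cbn in Hmin. unfold Phi in Hmin.
    assert (Hdom : t <= r' < t2) by (unfold x in *; lra).
    specialize (Hmin (conj Hdom Hy')). fold x in Hmin.
    replace (x - (r' - r)) with (t2 - r') in Hinv by (unfold x; ring). lra. }
  assert (Hlam3 : 0 < 2 * lam / x ^ 3) by
    (apply Rdiv_lt_0_compat; [lra|now apply pow_lt]).
  assert (HlX : Rabs (q * X r) <= Rabs q * B0).
  { rewrite Rabs_mult. apply Rmult_le_compat_l; [apply Rabs_pos|apply HX; lra]. }
  destruct (Rle_lt_or_eq_dec 0 y Hy) as [Py|<-].
  - assert (Hall : forall p, b + py j r y * p - L j p <= 0).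
    { apply (Hint j r y b (py j r y) K2 d Hj ltac:(lra) Py Hd).
      intros r' y' Hr' Hy' H1 _.
      eapply Rle_trans; [now apply Htouch|].
      pose proof (Hpen j r y r' y') as [_ Hp]. unfold b, K2.
      pose proof (pow2_ge_0 (y' - y)). nra. }
    unfold b, pr, py in Hall. destruct (Nat.eq_dec j i) as [->|Hne].
    (* The penalty is invariant in the direction of the path, so its time and space slopes cancel at
       speed [q]. *)
    + specialize (Hall q). fold l in Hall. lra.
    + specialize (Hall 1). destruct (HP j Hj) as (_ & H2 & _).
      pose proof (Rle_abs (- (q * X r))) as Ha. rewrite Rabs_Ropp in Ha. nra.
  - destruct (Rle_dec s' s) as [Hle|Hgt].
    + assert (Hq : q <= 0).
      { unfold q. assert (0 <= (s - s') / (t' - t)).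
        { apply Rmult_le_pos; [lra|left; apply Rinv_0_lt_compat; lra]. }
        replace ((s' - s) / (t' - t)) with (- ((s - s') / (t' - t))) by (field; lra). lra. }
      assert (Hp0 : forall j', pen j' r 0 = pen j r 0).
      { intros j'. unfold pen. destruct (Nat.eq_dec j' i), (Nat.eq_dec j i); ring. }
      assert (Hpr0 : forall j', pr j' r 0 = pr j r 0).
      { intros j'. unfold pr. destruct (Nat.eq_dec j' i), (Nat.eq_dec j i); ring. }
      assert (Hall : b + py i r 0 * q - L i q <= 0).
      { apply (Hver j r b (fun j => py j r 0) K2 d Hj ltac:(lra) Hd); auto.
        intros j' r' y' Hj' Hr' Hy' H1 _.
        eapply Rle_trans; [now apply Htouch|].
        pose proof (Hpen j' r 0 r' y') as [_ Hp]. rewrite Hp0, Hpr0 in Hp.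
        rewrite Rminus_0_r in Hp. unfold b, K2.
        pose proof (pow2_ge_0 y'). nra. }
      unfold b in Hall. rewrite <- (Hpr0 i) in Hall. unfold pr, py in Hall.
      destruct (Nat.eq_dec i i); [|easy]. fold l in Hall. lra.
    (* Outward path: [X] stays above [s], so by the choice of [E] the value at the vertex is too
       large for a minimum. *)
    + destruct Hss as [Hss|Ps]; [lra|].
      assert (Hq : 0 < q) by (unfold q; apply Rdiv_lt_0_compat; lra).
      assert (HXs : s <= X r) by (unfold X; nra).
      specialize (HE2 Ps).
      pose proof (Hgrow j r 0 Hj ltac:(lra) ltac:(lra)) as Hg.
      assert (E * s ^ 2 <= pen j r 0).
      { assert (E * s ^ 2 <= E * X r ^ 2) by (apply Rmult_le_compat_l; nra).
        unfold pen. destruct (Nat.eq_dec j i); lra. }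
      assert (lam / (t2 - t) <= lam / (t2 - r)).
      { apply Rmult_le_compat_l; [lra|]. apply Rinv_le_contravar; lra. }
      assert (- (T * Rabs l) <= (r - t) * l).
      { pose proof (Rle_abs (- l)) as Hl. rewrite Rabs_Ropp in Hl.
        pose proof (Rabs_pos l). nra. }
      unfold Phi in Hlow. lra.
Qed.

Lemma suboptimality N L T U C i t t' s s' :
  branch_subsolution N L T U -> 0 <= C ->
  (forall j r y, (j < N)%nat -> 0 <= r < T -> 0 <= y -> U j r y <= C * (1 + y)) ->
  continuity (L i) ->
  (i < N)%nat -> 0 <= t < t' -> t' < T -> 0 <= s -> 0 <= s' ->
  U i t' s' <= U i t s + action (L i) (t' - t) (s' - s).
Proof.
  intros HU HC Hgrow HL Hi Ht Ht' Hs Hs'.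
  destruct (Rle_dec s' s) as [Hle|Hgt];
    [apply (suboptimality_off_vertex N L T U C); auto|].
  destruct (Rle_lt_or_eq_dec 0 s Hs) as [Ps|<-];
    [apply (suboptimality_off_vertex N L T U C); auto|].
  (* Start from s > 0 and let s tend to 0, by upper semicontinuity of U. *)
  apply Rle_plus_epsilon. intros eps He.
  destruct (bsub_usc _ _ _ _ HU i t 0 Hi ltac:(lra) ltac:(lra) (eps / 2) ltac:(lra))
    as [d [Hd HdU]].
  set (h := t' - t). assert (Hh : 0 < h) by (unfold h; lra).
  destruct (HL ((s' - 0) / h) (eps / (2 * h))) as [a [Ha HaL]].
  { apply Rdiv_lt_0_compat; lra. }
  set (x := Rmin (d / 2) (a * h / 2)).
  assert (Hah : 0 < a * h) by (apply Rmult_lt_0_compat; lra).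
  assert (Hx : 0 < x) by (apply Rmin_glb_lt; lra).
  assert (Hxd : x <= d / 2) by apply Rmin_l.
  assert (Hxa : x <= a * h / 2) by apply Rmin_r.
  pose proof (suboptimality_off_vertex N L T U C i t t' x s' HU HC Hgrow Hi Ht Ht'
    ltac:(lra) Hs' (or_intror Hx)) as H1.
  specialize (HdU t x ltac:(lra) ltac:(lra)).
  rewrite Rminus_diag, Rabs_R0, Rminus_0_r, Rabs_pos_eq in HdU by lra.
  specialize (HdU Hd ltac:(lra)).
  assert (HL2 : Rabs (L i ((s' - x) / h) - L i ((s' - 0) / h)) < eps / (2 * h)).
  { apply HaL. split.
    - split; [exact I|]. intros E.
      assert (E' : (s' - 0) / h * h = (s' - x) / h * h) by now rewrite E.
      replace ((s' - 0) / h * h) with s' in E' by (field; lra).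
      replace ((s' - x) / h * h) with (s' - x) in E' by (field; lra). lra.
    - cbn. unfold Rdist.
      replace ((s' - x) / h - (s' - 0) / h) with (- (x / h)) by (field; lra).
      rewrite Rabs_Ropp, Rabs_pos_eq
        by (apply Rmult_le_pos; [lra|left; now apply Rinv_0_lt_compat]).
      apply (Rmult_lt_reg_r h); [auto|].
      replace (x / h * h) with x by (field; lra). lra. }
  unfold action in *. fold h in H1 |- *.
  apply Rabs_def2 in HL2. destruct HL2 as [HL2 _].
  apply (Rmult_lt_compat_l h) in HL2; [|auto].
  replace (h * (eps / (2 * h))) with (eps / 2) in HL2 by (field; lra). lra.
Qed.

(** * Least action through the vertex *)

Lemma action_0 F : action F 0 0 = 0.
Proof. unfold action. ring. Qed.

(** The quadratic remainder at speed 0 is split: one half, at least [gamma / (4 * T) * z ^ 2],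
    absorbs the linear terms; the other is kept because it blows up for short durations. *)
Lemma action_coercive gamma F F1 T w : uniformly_convex gamma F F1 -> 0 < T ->
  exists Q, forall th z, 0 <= th <= T -> (th = 0 -> z = 0) ->
    w * Rabs z - Q + gamma / 4 * (z ^ 2 / th) <= action F th z.
Proof.
  intros HF HT. pose proof HF as (Hg & _).
  set (v := w + Rabs (F1 0)). set (E := gamma / (4 * T)).
  assert (HE : 0 < E) by (apply Rdiv_lt_0_compat; lra).
  exists (T * Rabs (F 0) + v ^ 2 / (4 * E)). intros th z Hth Hz.
  assert (0 <= v ^ 2 / (4 * E)).
  { apply Rmult_le_pos; [apply pow2_ge_0|left; apply Rinv_0_lt_compat; lra]. }
  pose proof (Rabs_pos (F 0)).
  destruct (Rle_lt_or_eq_dec 0 th (proj1 Hth)) as [Pth|<-].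
  2:{ rewrite (Hz eq_refl), action_0, Rabs_R0. unfold Rdiv at 3. nra. }
  pose proof (action_lower gamma F F1 0 th z HF Pth) as Hlow.
  unfold tangent_value in Hlow. rewrite !Rmult_0_l, !Rminus_0_r in Hlow.
  pose proof (quadratic_lower E v (Rabs z) HE) as Hq. rewrite pow2_abs in Hq.
  assert (HEz : E * z ^ 2 <= gamma / 4 * (z ^ 2 / th)).
  { assert (Hi : / T <= / th) by (apply Rinv_le_contravar; lra).
    pose proof (pow2_ge_0 z). unfold E.
    replace (gamma / (4 * T) * z ^ 2) with (gamma / 4 * (z ^ 2 * / T)) by (field; lra).
    apply Rmult_le_compat_l; [lra|]. now apply Rmult_le_compat_l. }
  assert (- (Rabs (F1 0) * Rabs z) <= F1 0 * z).
  { rewrite <- Rabs_mult. pose proof (Rle_abs (- (F1 0 * z))) as Ha.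
    rewrite Rabs_Ropp in Ha. lra. }
  assert (- (T * Rabs (F 0)) <= th * F 0).
  { pose proof (Rle_abs (- F 0)) as Ha. rewrite Rabs_Ropp in Ha. nra. }
  assert (v * Rabs z = w * Rabs z + Rabs (F1 0) * Rabs z) by (unfold v; ring). lra.
Qed.

(* The least action from the vertex to the point [a] of a branch in time [tau],
   when waiting at the vertex costs [tangent_value F F1 qs] per unit of time:
   travel at speed [a / tau] if this exceeds [qs], and otherwise wait first and
   then travel at speed [qs]. *)
Definition vertex_action (F F1 : R -> R) (qs a tau : R) : R :=
  tau * tangent_value F F1 (Rmax (a / tau) qs) + F1 (Rmax (a / tau) qs) * a.

Lemma tangent_value_decreasing gamma F F1 q r : uniformly_convex gamma F F1 ->
  0 <= q <= r ->
  0 <= F1 r - F1 q /\ q * (F1 r - F1 q) <= tangent_value F F1 q - tangent_value F F1 r.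
Proof.
  intros (Hg & _ & _ & Hlow & _) Hqr. unfold tangent_value.
  pose proof (Hlow q r). pose proof (Hlow r q). pose proof (pow2_ge_0 (r - q)).
  pose proof (pow2_ge_0 (q - r)). split; [|nra].
  destruct (Req_dec q r) as [<-|Hne]; [lra|].
  assert (0 <= (F1 r - F1 q) * (r - q)) by nra.
  apply Rnot_lt_le. intros Hc. nra.
Qed.

(** Thus [vertex_action] is the supremum of these affine functions over [q >= qs], and therefore
    convex in [tau]. Over all [q] the supremum would be the direct action. *)
Lemma vertex_action_ge gamma F F1 qs a tau q : uniformly_convex gamma F F1 ->
  0 <= qs <= q -> 0 < tau ->
  tau * tangent_value F F1 q + F1 q * a <= vertex_action F F1 qs a tau.
Proof.
  intros HF Hq Htau. unfold vertex_action, Rmax.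
  destruct (Rle_dec (a / tau) qs) as [Hle|Hgt].
  - destruct (tangent_value_decreasing gamma F F1 qs q HF Hq) as [H1 H2].
    assert (a <= qs * tau).
    { apply (Rmult_le_compat_r tau) in Hle; [|lra].
      replace (a / tau * tau) with a in Hle by (field; lra). auto. }
    nra.
  - rewrite <- action_eq by auto. now apply action_tangent with gamma.
Qed.

Lemma vertex_action_le gamma F F1 qs a tau : uniformly_convex gamma F F1 ->
  0 < tau -> vertex_action F F1 qs a tau <= action F tau a.
Proof. intros HF Htau. now apply action_tangent with gamma. Qed.

(** The slope is the tangent value at the optimal speed, which is at least [qs], so it never exceeds
    the waiting cost. For the upper bound: if [a / tau < qs] the function is affine nearby,
    otherwise it lies below the direct action and equals it at [tau]. *)
Lemma vertex_action_slope gamma F F1 qs a tau : uniformly_convex gamma F F1 ->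
  0 <= qs -> 0 <= a -> 0 < tau ->
  exists z K d, z <= tangent_value F F1 qs /\ 0 <= K /\ 0 < d /\
    (forall tau', 0 < tau' ->
       vertex_action F F1 qs a tau + z * (tau' - tau) <= vertex_action F F1 qs a tau') /\
    (forall tau', Rabs (tau' - tau) < d -> 0 < tau' /\
       vertex_action F F1 qs a tau'
       <= vertex_action F F1 qs a tau + z * (tau' - tau) + K * (tau' - tau) ^ 2).
Proof.
  intros HF Hqs Ha Htau.
  set (q := Rmax (a / tau) qs).
  assert (Hq : qs <= q) by apply Rmax_r.
  assert (Hup : exists K d, 0 <= K /\ 0 < d /\ forall tau', Rabs (tau' - tau) < d ->
    0 < tau' /\ vertex_action F F1 qs a tau'
       <= tau' * tangent_value F F1 q + F1 q * a + K * (tau' - tau) ^ 2).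
  { destruct (Rlt_dec (a / tau) qs) as [Hlt|Hge].
    - assert (Eq : q = qs) by (apply Rmax_right; lra). rewrite Eq.
      assert (Hqs' : 0 < qs).
      { eapply Rle_lt_trans; [|exact Hlt].
        apply Rmult_le_pos; [auto|left; now apply Rinv_0_lt_compat]. }
      assert (Htau' : a < qs * tau).
      { apply (Rmult_lt_compat_r tau) in Hlt; [|lra].
        replace (a / tau * tau) with a in Hlt by (field; lra). auto. }
      assert (Hd : a / qs < tau).
      { apply (Rmult_lt_reg_r qs); [auto|].
        replace (a / qs * qs) with a by (field; lra). lra. }
      assert (0 <= a / qs) by (apply Rmult_le_pos; [auto|left; now apply Rinv_0_lt_compat]).
      exists 0, (tau - a / qs). split; [lra|]. split; [lra|]. intros tau' H'.
      apply Rabs_def2 in H'. assert (Hp : 0 < tau') by lra. split; [auto|].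
      unfold vertex_action. rewrite Rmax_right; [lra|].
      apply (Rmult_le_reg_r tau'); [auto|].
      replace (a / tau' * tau') with a by (field; lra).
      assert (Hx : a / qs < tau') by lra. apply (Rmult_lt_compat_r qs) in Hx; [|auto].
      replace (a / qs * qs) with a in Hx by (field; lra). lra.
    - assert (Eq : q = a / tau) by (apply Rmax_left; lra). rewrite Eq.
      destruct (action_upper gamma F F1 tau a HF Htau) as (K & d & HK & Hd & H).
      exists K, d. split; [auto|]. split; [auto|]. intros tau' H'.
      destruct (H tau' a H') as [H1 H2]; [now rewrite Rminus_diag, Rabs_R0|].
      split; [auto|]. eapply Rle_trans; [now apply vertex_action_le with gamma|].
      rewrite Rminus_diag in H2. lra. }
  destruct Hup as (K & d & HK & Hd & Hup).
  exists (tangent_value F F1 q), K, d. split; [|split; [auto|split; [auto|split]]].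
  - destruct (tangent_value_decreasing gamma F F1 qs q HF ltac:(lra)). nra.
  - intros tau' H'. unfold vertex_action at 1. fold q.
    eapply Rle_trans; [|apply (vertex_action_ge gamma F F1 qs a tau' q); auto; lra]. lra.
  - intros tau' H'. destruct (Hup tau' H') as [H1 H2]. split; [auto|].
    eapply Rle_trans; [exact H2|]. unfold vertex_action. fold q. lra.
Qed.

Definition suboptimal (N : nat) (L : nat -> R -> R) (S1 : R) (W : nat -> R -> R -> R) :=
  forall i t t' s s', (i < N)%nat -> 0 <= t < t' -> t' <= S1 -> 0 <= s -> 0 <= s' ->
    W i t' s' <= W i t s + action (L i) (t' - t) (s' - s).

(** An explicit path realises the value: when [a / tau < qs], wait at the vertex until [S1 - a / qs]
    at the rate [L i0 0], then travel at speed [qs]. The costs add up because the tangent at [qs]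
    has intercept [L i0 0]. *)
Lemma suboptimal_vertex_action N L S1 W k i0 F1 qs a tau :
  suboptimal N L S1 W ->
  (forall i j t, (i < N)%nat -> (j < N)%nat -> W i t 0 = W j t 0) ->
  (k < N)%nat -> (i0 < N)%nat -> 0 <= qs -> tangent_value (L k) F1 qs = L i0 0 ->
  0 <= a -> 0 < tau <= S1 ->
  W k S1 a <= W k (S1 - tau) 0 + vertex_action (L k) F1 qs a tau.
Proof.
  intros HW Hv Hk Hi0 Hqs Eqs Ha Htau. unfold vertex_action, Rmax.
  destruct (Rle_dec (a / tau) qs) as [Hle|Hgt].
  - destruct (Req_dec (a / tau) qs) as [E|Hne].
    { rewrite <- E, <- action_eq by lra.
      pose proof (HW k (S1 - tau) S1 0 a Hk ltac:(lra) ltac:(lra) ltac:(lra) Ha) as H.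
      replace (S1 - (S1 - tau)) with tau in H by ring. now rewrite Rminus_0_r in H. }
    assert (Hat : 0 <= a / tau) by
      (apply Rmult_le_pos; [auto|left; now apply Rinv_0_lt_compat]).
    assert (Hqs' : 0 < qs) by lra.
    set (th := a / qs).
    assert (Hth0 : 0 <= th) by
      (apply Rmult_le_pos; [auto|left; now apply Rinv_0_lt_compat]).
    assert (Eth : th * qs = a) by (unfold th; field; lra).
    assert (Hth : th < tau).
    { apply (Rmult_lt_reg_r qs); [auto|]. rewrite Eth.
      assert (H : a / tau < qs) by lra. apply (Rmult_lt_compat_r tau) in H; [|lra].
      replace (a / tau * tau) with a in H by (field; lra). lra. }
    assert (H1 : W k (S1 - th) 0 <= W k (S1 - tau) 0 + (tau - th) * L i0 0).
    { rewrite (Hv k i0), (Hv k i0 (S1 - tau)) by auto.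
      pose proof (HW i0 (S1 - tau) (S1 - th) 0 0 Hi0 ltac:(lra) ltac:(lra)
        ltac:(lra) ltac:(lra)) as H.
      unfold action in H. replace (S1 - th - (S1 - tau)) with (tau - th) in H by ring.
      replace ((0 - 0) / (tau - th)) with 0 in H by (field; lra). lra. }
    assert (H2 : W k S1 a <= W k (S1 - th) 0 + th * L k qs).
    { destruct (Rle_lt_or_eq_dec 0 th Hth0) as [Pth|E0].
      - pose proof (HW k (S1 - th) S1 0 a Hk ltac:(lra) ltac:(lra) ltac:(lra) Ha) as H.
        unfold action in H. replace (S1 - (S1 - th)) with th in H by ring.
        replace ((a - 0) / th) with qs in H; [auto|]. rewrite <- Eth. field. lra.
      - rewrite <- E0, Rmult_0_l in Eth. rewrite <- E0, <- Eth, Rminus_0_r. lra. }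
    unfold tangent_value in *. nra.
  - rewrite <- action_eq by lra.
    pose proof (HW k (S1 - tau) S1 0 a Hk ltac:(lra) ltac:(lra) ltac:(lra) Ha) as H.
    replace (S1 - (S1 - tau)) with tau in H by ring. now rewrite Rminus_0_r in H.
Qed.

(** * Super-solutions lie above the action *)

(** The endpoint [(rho, c)] of the path stays fixed. The tangent plane of the action solves the
    equation exactly, [- tangent_value] being the Hamiltonian at [F1 q], so the test would give
    [0 <= - lam / x ^ 2]. *)
Lemma supersolution_no_interior_min N L T V gamma F1 i rho c lam t2 t s d :
  branch_supersolution N L T V -> uniformly_convex gamma (L i) F1 -> (i < N)%nat ->
  0 < lam -> 0 < t < t2 -> t2 < T -> t < rho -> 0 < s -> 0 < d ->
  (forall t' s', Rabs (t' - t) < d -> Rabs (s' - s) < d ->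
     V i t s + action (L i) (rho - t) (c - s) + lam / (t2 - t)
     <= V i t' s' + action (L i) (rho - t') (c - s') + lam / (t2 - t')) ->
  False.
Proof.
  intros HV HF Hi Hlam Ht Ht2 Hrho Hs Hd Hmin.
  destruct (action_upper gamma (L i) F1 (rho - t) (c - s) HF ltac:(lra))
    as (K & d1 & HK & Hd1 & Hup).
  rewrite (action_eq (L i) F1) in Hmin by lra.
  set (q := (c - s) / (rho - t)) in *.
  set (x := t2 - t) in *. assert (Hx : 0 < x) by (unfold x; lra).
  assert (Hlx : 0 < lam / x ^ 2) by (apply Rdiv_lt_0_compat; [auto|now apply pow_lt]).
  assert (Hlx3 : 0 < 2 * lam / x ^ 3) by
    (apply Rdiv_lt_0_compat; [lra|now apply pow_lt]).
  set (d2 := Rmin d (Rmin d1 (x / 2))).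
  assert (Hd2 : 0 < d2) by (repeat apply Rmin_glb_lt; lra).
  assert (Hd2a : d2 <= d) by apply Rmin_l.
  assert (Hd2b : d2 <= Rmin d1 (x / 2)) by apply Rmin_r.
  pose proof (Rmin_l d1 (x / 2)). pose proof (Rmin_r d1 (x / 2)).
  assert (0 <= tangent_value (L i) F1 q - lam / x ^ 2 + - tangent_value (L i) F1 q);
    [|lra].
  apply (bsup_interior_test _ _ _ _ HV i t s _ (F1 q) (K + 2 * lam / x ^ 3) d2); auto;
    [lra| |].
  - intros t' s' Ht' Hs' H1 H2.
    specialize (Hmin t' s' ltac:(lra) ltac:(lra)).
    destruct (Hup (rho - t') (c - s')) as [_ Hu].
    { replace (rho - t' - (rho - t)) with (- (t' - t)) by ring.
      rewrite Rabs_Ropp. lra. }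
    { replace (c - s' - (c - s)) with (- (s' - s)) by ring. rewrite Rabs_Ropp. lra. }
    replace (rho - t' - (rho - t)) with (- (t' - t)) in Hu by ring.
    replace (c - s' - (c - s)) with (- (s' - s)) in Hu by ring.
    pose proof (inv_upper lam x (t' - t) ltac:(lra) Hx ltac:(lra)) as Hinv.
    replace (x - (t' - t)) with (t2 - t') in Hinv by (unfold x; ring).
    pose proof (pow2_ge_0 (s' - s)). nra.
  - intros r. destruct HF as (Hg & _ & _ & Hlow & _). specialize (Hlow q r).
    pose proof (pow2_ge_0 (r - q)). unfold tangent_value. nra.
Qed.

(** This is the space slope of minus the action of a path entering the vertex at speed [c], when [z]
    is the slope of the remaining cost in the remaining time. If the tangent at [- c] has intercept
    [z - mu], it equals [F1 (- c) + mu / c], and the extra term is favourable for [q <= 0].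
    Positivity of [mu] excludes [c = 0]. *)
Lemma incoming_slope gamma F F1 z mu : uniformly_convex gamma F F1 -> z <= F 0 -> 0 < mu ->
  exists c, 0 < c /\ forall q, q <= 0 -> (z - F (- c)) / c * q - F q <= - z + mu.
Proof.
  intros HF Hz Hmu.
  destruct (tangent_value_onto gamma F F1 (z - mu) HF ltac:(lra)) as [_ [q0 [Hq0 E]]].
  assert (Hne : q0 <> 0).
  { intros ->. unfold tangent_value in E. lra. }
  exists (- q0). split; [lra|]. intros q Hq. rewrite Ropp_involutive.
  destruct HF as (Hg & _ & _ & Hlow & _). specialize (Hlow q0 q).
  unfold tangent_value in E.
  replace ((z - F q0) / - q0) with (F1 q0 + mu / - q0)
    by (replace (F q0) with (z - mu + q0 * F1 q0) by lra; field; lra).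
  assert (0 < mu / - q0) by (apply Rdiv_lt_0_compat; lra).
  pose proof (pow2_ge_0 (q - q0)). nra.
Qed.

(** From the point [s'] of branch [j] the vertex is reached at speed [c j] after the time
    [g = s' / c j]. Inserting this path in the minimality yields a lower test function that is
    quadratic in [t'] and [s']. *)
Lemma supersolution_no_vertex_min N L T V gamma L1 Z S1 lam t2 t j0 z K dz :
  branch_supersolution N L T V ->
  (forall j, (j < N)%nat -> uniformly_convex gamma (L j) (L1 j)) ->
  (j0 < N)%nat -> 0 < lam -> 0 < t < t2 -> t2 < T ->
  (forall j, (j < N)%nat -> z <= L j 0) -> 0 <= K -> 0 < dz ->
  (forall tau, Rabs (tau - (S1 - t)) < dz ->
     Z tau <= Z (S1 - t) + z * (tau - (S1 - t)) + K * (tau - (S1 - t)) ^ 2) ->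
  (forall j t' s' rho, (j < N)%nat -> 0 <= t' < t2 -> 0 <= s' -> t' <= rho <= t2 ->
     (rho = t' -> s' = 0) ->
     V j0 t 0 + Z (S1 - t) + lam / (t2 - t)
     <= V j t' s' + (action (L j) (rho - t') (0 - s') + Z (S1 - rho) + lam / (t2 - t'))) ->
  False.
Proof.
  intros HV HL Hj0 Hlam Ht Ht2 Hz HK Hdz HZ Hmin.
  set (x := t2 - t) in *. assert (Hx : 0 < x) by (unfold x; lra).
  assert (Hlx : 0 < lam / x ^ 2) by (apply Rdiv_lt_0_compat; [auto|now apply pow_lt]).
  assert (Hlx3 : 0 < 2 * lam / x ^ 3) by
    (apply Rdiv_lt_0_compat; [lra|now apply pow_lt]).
  (* Half of the barrier slope, so that a strict inequality remains. *)
  set (mu := lam / x ^ 2 / 2).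
  assert (Hc : forall j, exists c, 0 < c /\ ((j < N)%nat ->
    forall q, q <= 0 -> (z - L j (- c)) / c * q - L j q <= - z + mu)).
  { intros j. destruct (Nat.le_gt_cases N j) as [Hge|Hlt].
    (* Default outside the family, so that [c] is positive at every index. *)
    - exists 1. split; [lra|]. intros. lia.
    - destruct (incoming_slope gamma (L j) (L1 j) z mu (HL j Hlt) (Hz j Hlt))
        as [c [Pc Hc]]; [unfold mu; lra|]. eauto. }
  pose (c := fun j => proj1_sig (constructive_indefinite_description _ (Hc j))).
  assert (Hcpos : forall j, 0 < c j) by (intros j;
    exact (proj1 (proj2_sig (constructive_indefinite_description _ (Hc j))))).
  assert (Hcslope : forall j, (j < N)%nat -> forall q, q <= 0 ->
    (z - L j (- c j)) / c j * q - L j q <= - z + mu) by (intros j;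
    exact (proj2 (proj2_sig (constructive_indefinite_description _ (Hc j))))).
  clearbody c.
  set (d0 := Rmin t (Rmin (dz / 2) (x / 2))).
  assert (Hd0 : 0 < d0) by (repeat apply Rmin_glb_lt; lra).
  assert (Hd0t : d0 <= t) by apply Rmin_l.
  assert (Hd0m : d0 <= Rmin (dz / 2) (x / 2)) by apply Rmin_r.
  pose proof (Rmin_l (dz / 2) (x / 2)). pose proof (Rmin_r (dz / 2) (x / 2)).
  destruct (fin_radius N (fun j d => d / c j <= d0)) as [d1 [Hd1 Hd1c]].
  { intros j d d' Hd Hdd. eapply Rle_trans; [|exact Hd].
    apply Rmult_le_compat_r; [|auto]. left. now apply Rinv_0_lt_compat. }
  { intros j _. exists (d0 * c j). split; [now apply Rmult_lt_0_compat|].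
    apply Req_le. field. specialize (Hcpos j). lra. }
  assert (0 <= z - lam / x ^ 2 + (- z + mu)); [|unfold mu in *; lra].
  (* The quadratic coefficients come from [(h + g) ^ 2 <= 2 * h ^ 2 + 2 * g ^ 2] with
     [g = s' / c j]. *)
  apply (bsup_vertex_test _ _ _ _ HV j0 t _ (fun j => (z - L j (- c j)) / c j)
    (2 * K + 2 * lam / x ^ 3) (fun j => 2 * K / c j ^ 2) (Rmin d0 d1)); auto;
    [lra|now apply Rmin_glb_lt|].
  intros j t' s' Hj Ht' Hs' H1 H2.
  pose proof (Rmin_l d0 d1). pose proof (Rmin_r d0 d1). pose proof (Hcpos j) as Hcj.
  set (h := t' - t) in *. set (g := s' / c j).
  assert (Hg0 : 0 <= g) by
    (apply Rmult_le_pos; [auto|left; now apply Rinv_0_lt_compat]).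
  assert (Hg : g < d0).
  { eapply Rlt_le_trans; [|now apply (Hd1c j)]. apply Rmult_lt_compat_r; [|lra].
    now apply Rinv_0_lt_compat. }
  assert (Es' : s' = g * c j) by (unfold g; field; lra).
  pose proof (inv_upper lam x h ltac:(lra) Hx ltac:(lra)) as Hinv.
  replace (x - h) with (t2 - t') in Hinv by (unfold x, h; ring).
  assert (Hh : - d0 < h < d0) by (apply Rabs_def2 in H1; lra).
  assert (Hm : V j0 t 0 + Z (S1 - t) + lam / x
    <= V j t' s' + (action (L j) (t' + g - t') (0 - s') + Z (S1 - (t' + g))
        + lam / (t2 - t'))).
  { apply Hmin; auto.
    - unfold h, x in *. lra.
    - unfold h, x in *. lra.
    - intros E. rewrite Es'. replace g with 0 by lra. ring. }
  replace (action (L j) (t' + g - t') (0 - s')) with (g * L j (- c j)) in Hm.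
  2:{ unfold action. replace (t' + g - t') with g by ring.
      destruct (Req_dec g 0) as [->|Hne]; [ring|].
      f_equal. f_equal. rewrite Es'. field. auto. }
  assert (HZ' := HZ (S1 - (t' + g))).
  replace (S1 - (t' + g) - (S1 - t)) with (- (h + g)) in HZ' by (unfold h; ring).
  assert (Hab : Rabs (- (h + g)) < dz) by (apply Rabs_def1; lra).
  specialize (HZ' Hab).
  replace ((z - L j (- c j)) / c j * s') with (z * g - g * L j (- c j))
    by (rewrite Es'; field; lra).
  replace (2 * K / c j ^ 2 * s' ^ 2) with (2 * K * g ^ 2) by (rewrite Es'; field; lra).
  assert (0 <= K * (h - g) ^ 2) by (apply Rmult_le_pos; [auto|apply pow2_ge_0]).
  nra.
Qed.

(** The admissible set is not closed where [rho = t] and [0 < s], but near such points the action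
    blows up like [s ^ 2 / (rho - t)]. The bounds [rho <= t2 < S1] keep the argument of [Z]
    positive. *)
Lemma path_via_vertex_attains_min N L T V gamma F1 Z C j S1 t2 lam :
  branch_supersolution N L T V -> uniformly_convex gamma (L j) F1 -> (j < N)%nat ->
  (forall r y, 0 <= r < T -> 0 <= y -> - C * (1 + y) <= V j r y) ->
  0 < lam -> 0 < t2 < T -> t2 < S1 ->
  (forall tau, 0 < tau -> exists z, forall tau', 0 < tau' ->
     Z tau + z * (tau' - tau) <= Z tau') ->
  exists t s rho, (0 <= t < t2 /\ 0 <= s /\ t <= rho <= t2 /\ (rho = t -> s = 0)) /\
    forall t' s' rho',
      0 <= t' < t2 /\ 0 <= s' /\ t' <= rho' <= t2 /\ (rho' = t' -> s' = 0) ->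
      V j t s + (action (L j) (rho - t) (0 - s) + Z (S1 - rho) + lam / (t2 - t))
      <= V j t' s' + (action (L j) (rho' - t') (0 - s') + Z (S1 - rho')
                      + lam / (t2 - t')).
Proof.
  intros HV HF Hj Hgrow Hlam Ht2 HS1 HZ.
  set (Dom := fun t s rho => 0 <= t < t2 /\ 0 <= s /\ t <= rho <= t2 /\
    (rho = t -> s = 0)).
  set (f := fun t s rho => V j t s + (action (L j) (rho - t) (0 - s) + Z (S1 - rho)
    + lam / (t2 - t))).
  assert (Hcoer : exists Q, forall t s rho, Dom t s rho ->
    s - Q + lam / (t2 - t) + gamma / 4 * (s ^ 2 / (rho - t)) <= f t s rho).
  { destruct (action_coercive gamma (L j) F1 T (C + 1) HF ltac:(lra)) as [Q1 HQ1].
    destruct (HZ S1 ltac:(lra)) as [z Hz].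
    exists (C + Q1 - (Z S1 - Rabs z * t2)). intros t s rho (Ht & Hs & Hrho & Hrs).
    pose proof (Hgrow t s ltac:(lra) Hs) as Hg.
    assert (Ha := HQ1 (rho - t) (0 - s) ltac:(lra)
      ltac:(intros E; rewrite Hrs by lra; ring)).
    replace ((0 - s) ^ 2) with (s ^ 2) in Ha by ring.
    rewrite Rabs_minus_sym, Rminus_0_r, Rabs_pos_eq in Ha by auto.
    pose proof (Hz (S1 - rho) ltac:(lra)) as Hzz.
    replace (S1 - rho - S1) with (- rho) in Hzz by ring.
    assert (- (Rabs z * t2) <= z * - rho).
    { pose proof (Rle_abs z). pose proof (Rabs_pos z). nra. }
    unfold f. lra. }
  destruct Hcoer as [Q HQ]. pose proof HF as (Hgam & _).
  assert (Hfrac : forall t s rho, t <= rho -> 0 <= gamma / 4 * (s ^ 2 / (rho - t))).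
  { intros t s rho H. apply Rmult_le_pos; [lra|].
    destruct (Rle_lt_or_eq_dec 0 (rho - t) ltac:(lra)) as [Hp|<-].
    - apply Rmult_le_pos; [apply pow2_ge_0|left; now apply Rinv_0_lt_compat].
    - unfold Rdiv. rewrite Rinv_0. lra. }
  apply (coercive_attains_min Dom f 0 0 0 lam Q 0 t2 0 t2 Hlam).
  - unfold Dom. repeat split; lra.
  - intros t s rho D. pose proof (HQ t s rho D). destruct D as (Ht & Hs & Hrho & _).
    pose proof (Hfrac t s rho ltac:(lra)). repeat split; lra.
  - intros t s rho m Ht Hs Hrho Hm.
    destruct (Rlt_dec rho t) as [Hlt|Hge].
    { exists ((t - rho) / 2). split; [lra|].
      intros t' s' rho' (_ & _ & H & _) H1 H2 H3.
      apply Rabs_def2 in H1, H3. lra. }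
    destruct (classic (rho = t -> s = 0)) as [Hrs|Hrs].
    + assert (D : Dom t s rho) by (unfold Dom; repeat split; auto; lra).
      specialize (Hm D).
      (* For [rho = t] also [s = 0], and any default speed gives the value 0. *)
      set (q := if Req_EM_T rho t then 0 else (0 - s) / (rho - t)).
      assert (Eq : action (L j) (rho - t) (0 - s)
        = (rho - t) * tangent_value (L j) F1 q + F1 q * (0 - s)).
      { unfold q. destruct (Req_EM_T rho t) as [E|Hne].
        - rewrite (Hrs E), E. unfold action. ring.
        - apply action_eq. lra. }
      destruct (HZ (S1 - rho) ltac:(lra)) as [z Hz].
      destruct (lsc_plus_affine (V j) (fun t s => 0 <= t < T /\ 0 <= s) t s rho
        (action (L j) (rho - t) (0 - s) + Z (S1 - rho) + lam / (t2 - t))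
        (- tangent_value (L j) F1 q + lam / (t2 - t) ^ 2) (- F1 q)
        (tangent_value (L j) F1 q - z) m) with (2 := Hm) as [d [Hd Hdd]].
      { intros eps He.
        destruct (bsup_lsc _ _ _ _ HV j t s Hj ltac:(lra) Hs eps He) as [d [Hd Hl]].
        exists d. split; [auto|]. intros t' s' []. auto. }
      exists d. split; [auto|]. intros t' s' rho' (Ht' & Hs' & Hrho' & Hrs') H1 H2 H3.
      eapply Rlt_le_trans; [apply (Hdd t' s' rho'); auto; lra|]. unfold f.
      assert (Ha : (rho' - t') * tangent_value (L j) F1 q + F1 q * (0 - s')
        <= action (L j) (rho' - t') (0 - s')).
      { destruct (Rle_lt_or_eq_dec t' rho' (proj1 Hrho')) as [Hp|E].
        - apply action_tangent with gamma; [auto|lra].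
        - rewrite (Hrs' (eq_sym E)), <- E. unfold action. lra. }
      pose proof (Hz (S1 - rho') ltac:(lra)) as Hzz.
      pose proof (inv_tangent lam (t2 - t) (t' - t) ltac:(lra) ltac:(lra) ltac:(lra))
        as Hinv.
      replace (t2 - t - (t' - t)) with (t2 - t') in Hinv by ring.
      rewrite Eq. lra.
    + assert (Hs0 : 0 < s /\ rho = t).
      { apply imply_to_and in Hrs. destruct Hrs as [E Hne]. split; [|auto]. lra. }
      destruct Hs0 as [Ps ->].
      set (B := Rabs (m + Q) + 1).
      assert (HB : 0 < B) by (unfold B; pose proof (Rabs_pos (m + Q)); lra).
      assert (Hgs : 0 < gamma * s ^ 2) by (apply Rmult_lt_0_compat; [auto|now apply pow_lt]).
      (* This gives [s' >= s / 2] and [rho' - t' <= gamma * s ^ 2 / (16 * B)], hence a singular term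
         of at least [B]. *)
      set (d := Rmin (s / 2) (gamma * s ^ 2 / (32 * B))).
      assert (Hd : 0 < d) by (apply Rmin_glb_lt; [lra|apply Rdiv_lt_0_compat; lra]).
      assert (Hda : d <= s / 2) by apply Rmin_l.
      assert (Hdb : d <= gamma * s ^ 2 / (32 * B)) by apply Rmin_r.
      exists d. split; [auto|]. intros t' s' rho' D H1 H2 H3.
      pose proof (HQ t' s' rho' D) as Hf. destruct D as (Ht' & Hs' & Hrho' & Hrs').
      apply Rabs_def2 in H1, H2, H3.
      assert (Hth : 0 < rho' - t').
      { destruct (Rle_lt_or_eq_dec t' rho' (proj1 Hrho')) as [Hp|E]; [lra|].
        specialize (Hrs' (eq_sym E)). lra. }
      assert (Hbig : B <= gamma / 4 * (s' ^ 2 / (rho' - t'))).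
      { apply (Rmult_le_reg_r (rho' - t')); [auto|].
        replace (gamma / 4 * (s' ^ 2 / (rho' - t')) * (rho' - t'))
          with (gamma / 4 * s' ^ 2) by (field; lra).
        assert (B * (rho' - t') <= B * (2 * (gamma * s ^ 2 / (32 * B))))
          by (apply Rmult_le_compat_l; lra).
        replace (B * (2 * (gamma * s ^ 2 / (32 * B)))) with (gamma * s ^ 2 / 16)
          in H by (field; lra).
        assert (s ^ 2 / 4 <= s' ^ 2) by nra. nra. }
      assert (0 < lam / (t2 - t')) by (apply Rdiv_lt_0_compat; lra).
      pose proof (Rle_abs (m + Q)). unfold B in Hbig. lra.
Qed.

Lemma direct_path_attains_min N L T V gamma F1 C k a S1 t2 lam :
  branch_supersolution N L T V -> uniformly_convex gamma (L k) F1 -> (k < N)%nat ->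
  0 <= C -> (forall r y, 0 <= r < T -> 0 <= y -> - C * (1 + y) <= V k r y) ->
  0 < lam -> 0 <= a -> 0 < t2 < T -> t2 < S1 <= T ->
  exists t s, (0 <= t < t2 /\ 0 <= s) /\
    forall t' s', 0 <= t' < t2 /\ 0 <= s' ->
      V k t s + (action (L k) (S1 - t) (a - s) + lam / (t2 - t))
      <= V k t' s' + (action (L k) (S1 - t') (a - s') + lam / (t2 - t')).
Proof.
  intros HV HF Hk HC Hgrow Hlam Ha Ht2 HS1.
  set (f := fun t s => V k t s + (action (L k) (S1 - t) (a - s) + lam / (t2 - t))).
  destruct (action_coercive gamma (L k) F1 T (C + 1) HF ltac:(lra)) as [Q1 HQ1].
  destruct HF as (Hgam & HF'). pose proof (conj Hgam HF') as HF.
  destruct (coercive_attains_min (fun t s z => 0 <= t < t2 /\ 0 <= s /\ z = 0)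
    (fun t s _ => f t s) 0 0 0 lam (C + Q1 + (C + 1) * a) 0 t2 0 0 Hlam)
    as (t & s & z & (Ht & Hs & _) & Hmin).
  - repeat split; lra.
  - intros t s z (Ht & Hs & ->). repeat split; try lra.
    pose proof (Hgrow t s ltac:(lra) Hs) as Hg.
    pose proof (HQ1 (S1 - t) (a - s) ltac:(lra) ltac:(lra)) as Hact.
    assert (0 <= gamma / 4 * ((a - s) ^ 2 / (S1 - t))).
    { apply Rmult_le_pos; [lra|].
      apply Rmult_le_pos; [apply pow2_ge_0|left; apply Rinv_0_lt_compat; lra]. }
    pose proof (Rle_abs (- (a - s))) as Habs. rewrite Rabs_Ropp in Habs.
    unfold f. nra.
  - intros t s z m Ht Hs Hz Hm.
    specialize (Hm ltac:(repeat split; lra)).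
    set (q := (a - s) / (S1 - t)).
    destruct (lsc_plus_affine (V k) (fun t s => 0 <= t < T /\ 0 <= s) t s z
      (action (L k) (S1 - t) (a - s) + lam / (t2 - t))
      (- tangent_value (L k) F1 q + lam / (t2 - t) ^ 2) (- F1 q) 0 m)
      with (2 := Hm) as [d [Hd Hdd]].
    { intros eps He.
      destruct (bsup_lsc _ _ _ _ HV k t s Hk ltac:(lra) Hs eps He) as [d [Hd Hl]].
      exists d. split; [auto|]. intros t' s' []. auto. }
    exists d. split; [auto|]. intros t' s' z' (Ht' & Hs' & _) H1 H2 H3.
    eapply Rlt_le_trans; [apply (Hdd t' s' z'); auto; lra|]. unfold f.
    pose proof (action_tangent gamma (L k) F1 q (S1 - t') (a - s') HF ltac:(lra)) as Hact.
    pose proof (inv_tangent lam (t2 - t) (t' - t) ltac:(lra) ltac:(lra) ltac:(lra))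
      as Hinv.
    replace (t2 - t - (t' - t)) with (t2 - t') in Hinv by ring.
    rewrite (action_eq (L k) F1 (S1 - t)) by lra. fold q. lra.
  - exists t, s. split; [auto|]. intros t' s' [Ht' Hs'].
    apply (Hmin t' s' 0). auto.
Qed.

(* [w0] minus the least action needed to reach the point [a] of branch [k] at
   time [S + eta] is a supremum of smooth solutions, and [V] stays above it. *)
Lemma supersolution_above_action N L T V gamma L1 C k a qs S eta w0 :
  branch_supersolution N L T V -> (1 <= N)%nat ->
  (forall j, (j < N)%nat -> uniformly_convex gamma (L j) (L1 j)) -> 0 <= C ->
  (forall j r y, (j < N)%nat -> 0 <= r < T -> 0 <= y -> - C * (1 + y) <= V j r y) ->
  (k < N)%nat -> 0 <= a -> 0 <= qs ->
  (forall j, (j < N)%nat -> tangent_value (L k) (L1 k) qs <= L j 0) ->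
  0 < S -> 0 < eta -> S + eta <= T ->
  (forall j s rho, (j < N)%nat -> 0 <= s -> 0 <= rho < S + eta -> (rho = 0 -> s = 0) ->
     w0 <= V j 0 s + (action (L j) rho (0 - s)
                      + vertex_action (L k) (L1 k) qs a (S + eta - rho))) ->
  (forall s, 0 <= s -> w0 <= V k 0 s + action (L k) (S + eta) (a - s)) ->
  w0 <= V k S a + eta * L k 0.
Proof.
  intros HV HN HL HC Hgrow Hk Ha Hqs Hwait HS Heta HT H0B H0A.
  apply Rle_plus_epsilon. intros eps Heps.
  (* The barrier time lies strictly between [S] and the target time, and the barrier at [S] equals
     [eps]. *)
  set (S1 := S + eta) in *. set (t2 := S + eta / 2). set (lam := eps * (eta / 2)).
  assert (Hlam : 0 < lam) by (apply Rmult_lt_0_compat; lra).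
  assert (Ht2 : S < t2 < S1) by (unfold t2, S1; lra).
  set (Z := vertex_action (L k) (L1 k) qs a) in *.
  assert (HZ : forall tau, 0 < tau ->
    exists z K d, z <= tangent_value (L k) (L1 k) qs /\ 0 <= K /\ 0 < d /\
      (forall tau', 0 < tau' -> Z tau + z * (tau' - tau) <= Z tau') /\
      (forall tau', Rabs (tau' - tau) < d -> 0 < tau' /\
         Z tau' <= Z tau + z * (tau' - tau) + K * (tau' - tau) ^ 2)).
  { intros tau Htau. apply vertex_action_slope with gamma; auto. }
  set (Phi := fun j t s rho => V j t s + (action (L j) (rho - t) (0 - s) + Z (S1 - rho)
    + lam / (t2 - t))).
  assert (Hpos : forall t, t < t2 -> 0 < lam / (t2 - t))
    by (intros t Ht; apply Rdiv_lt_0_compat; lra).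
  (* Paths through the vertex are treated separately, as they settle the case of a direct path whose
     optimal start is the vertex. *)
  assert (HB : forall j t s rho, (j < N)%nat ->
    0 <= t < t2 /\ 0 <= s /\ t <= rho <= t2 /\ (rho = t -> s = 0) ->
    w0 <= Phi j t s rho).
  { destruct (fin_family_min (R * R * R)
      (fun _ p => let '(t, s, rho) := p in
         0 <= t < t2 /\ 0 <= s /\ t <= rho <= t2 /\ (rho = t -> s = 0))
      (fun j p => let '(t, s, rho) := p in Phi j t s rho) N HN)
      as (j & [[t s] rho] & Hj & (Ht & Hs & Hrho & Hrs) & Hmin).
    { intros j Hj.
      destruct (path_via_vertex_attains_min N L T V gamma (L1 j) Z C j S1 t2 lam)
        as (t & s & rho & D & Hm); auto; try lra.
      - intros tau Htau. destruct (HZ tau Htau) as (z & _ & _ & _ & _ & _ & H & _).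
        now exists z.
      - exists (t, s, rho). split; [exact D|]. intros [[t' s'] rho']. apply Hm. }
    assert (Hmin' : forall j' t' s' rho', (j' < N)%nat -> 0 <= t' < t2 -> 0 <= s' ->
      t' <= rho' <= t2 -> (rho' = t' -> s' = 0) -> Phi j t s rho <= Phi j' t' s' rho').
    { intros j' t' s' rho' H1 H2 H3 H4 H5. apply (Hmin j' (t', s', rho')); auto. }
    clear Hmin.
    cut (w0 <= Phi j t s rho).
    { intros Hw j' t' s' rho' Hj' (H2 & H3 & H4 & H5).
      eapply Rle_trans; [exact Hw|]. apply Hmin'; auto. }
    destruct (Rle_lt_or_eq_dec 0 t (proj1 Ht)) as [Pt|<-].
    2:{ unfold Phi. rewrite !Rminus_0_r. pose proof (Hpos 0 ltac:(lra)) as Hp.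
        rewrite Rminus_0_r in Hp.
        pose proof (H0B j s rho Hj Hs ltac:(lra) Hrs). lra. }
    exfalso. destruct (Rle_lt_or_eq_dec 0 s Hs) as [Ps|<-].
    - assert (Hrt : t < rho).
      { destruct (Rle_lt_or_eq_dec t rho (proj1 Hrho)) as [|E]; [auto|].
        specialize (Hrs (eq_sym E)). lra. }
      set (d := Rmin s (Rmin t (Rmin (rho - t) (t2 - t)))).
      apply (supersolution_no_interior_min N L T V gamma (L1 j) j rho 0 lam t2 t s d);
        auto; try lra.
      { unfold d. repeat apply Rmin_glb_lt; lra. }
      intros t' s' H1 H2. apply Rabs_def2 in H1, H2.
      assert (d <= s) by apply Rmin_l.
      assert (d <= Rmin t (Rmin (rho - t) (t2 - t))) by apply Rmin_r.
      pose proof (Rmin_l t (Rmin (rho - t) (t2 - t))).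
      pose proof (Rmin_r t (Rmin (rho - t) (t2 - t))).
      pose proof (Rmin_l (rho - t) (t2 - t)). pose proof (Rmin_r (rho - t) (t2 - t)).
      pose proof (Hmin' j t' s' rho Hj ltac:(lra) ltac:(lra) ltac:(lra) ltac:(intros; lra)).
      unfold Phi in *. lra.
    (* Waiting at the vertex until [rho] is no better than using [Z] at once, since its slope [z] is
       at most [L j 0]. *)
    - destruct (HZ (S1 - t) ltac:(lra)) as (z & K & d & Hz & HK & Hd & Hlow & Hup).
      apply (supersolution_no_vertex_min N L T V gamma L1 Z S1 lam t2 t j z K d);
        auto; try lra.
      { intros j' Hj'. specialize (Hwait j' Hj'). lra. }
      { intros tau Htau. now apply Hup. }
      intros j' t' s' rho' Hj' Ht' Hs' Hrho' Hrs'.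
      eapply Rle_trans; [|apply (Hmin' j' t' s' rho'); auto].
      unfold Phi. specialize (Hlow (S1 - rho) ltac:(lra)).
      unfold action. replace ((0 - 0) / (rho - t)) with 0 by (unfold Rdiv; ring).
      specialize (Hwait j Hj). nra. }
  destruct (direct_path_attains_min N L T V gamma (L1 k) C k a S1 t2 lam)
    as (t & s & (Ht & Hs) & Hmin); auto; try lra.
  assert (Hw : w0 <= V k t s + (action (L k) (S1 - t) (a - s) + lam / (t2 - t))).
  { destruct (Rle_lt_or_eq_dec 0 t (proj1 Ht)) as [Pt|<-].
    2:{ rewrite !Rminus_0_r. pose proof (Hpos 0 ltac:(lra)) as Hp.
        rewrite Rminus_0_r in Hp. specialize (H0A s Hs). lra. }
    destruct (Rle_lt_or_eq_dec 0 s Hs) as [Ps|<-].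
    - exfalso. set (d := Rmin s (Rmin t (t2 - t))).
      apply (supersolution_no_interior_min N L T V gamma (L1 k) k S1 a lam t2 t s d);
        auto; try lra.
      { unfold d. repeat apply Rmin_glb_lt; lra. }
      intros t' s' H1 H2. apply Rabs_def2 in H1, H2.
      assert (d <= s) by apply Rmin_l.
      assert (d <= Rmin t (t2 - t)) by apply Rmin_r.
      pose proof (Rmin_l t (t2 - t)). pose proof (Rmin_r t (t2 - t)).
      specialize (Hmin t' s' ltac:(lra)). lra.
    (* A direct path from the vertex is compared with [rho = t]: [Z] lies below its action. *)
    - pose proof (HB k t 0 t Hk ltac:(repeat split; lra)) as Hw. unfold Phi in Hw.
      rewrite !Rminus_diag, action_0 in Hw.
      pose proof (vertex_action_le gamma (L k) (L1 k) qs a (S1 - t) (HL k Hk)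
        ltac:(lra)) as Hle.
      fold Z in Hle. rewrite (Rminus_0_r a). lra. }
  (* From [(S, a)] the direct path stands still during [eta]. *)
  specialize (Hmin S a ltac:(lra)).
  replace (action (L k) (S1 - S) (a - a)) with (eta * L k 0) in Hmin.
  2:{ unfold action. replace (S1 - S) with eta by (unfold S1; ring).
      replace ((a - a) / eta) with 0 by (field; lra). reflexivity. }
  replace (lam / (t2 - S)) with eps in Hmin by (unfold lam, t2; field; lra). lra.
Qed.

(** * Comparison *)

(* Before time [eta] the shifted function is [u0 + C' (eta - t)], whose slope in
   time absorbs the Lipschitz constant [M] of [u0]. *)
Lemma suboptimal_shift N L T U (g0 : nat -> R -> R) M C' eta S :
  (forall i t t' s s', (i < N)%nat -> 0 <= t < t' -> t' < T -> 0 <= s -> 0 <= s' ->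
     U i t' s' <= U i t s + action (L i) (t' - t) (s' - s)) ->
  (forall i s, (i < N)%nat -> 0 <= s -> U i 0 s <= g0 i s) ->
  (forall i s s', (i < N)%nat -> 0 <= s -> 0 <= s' ->
     g0 i s' <= g0 i s + M * Rabs (s' - s)) ->
  (forall i q, (i < N)%nat -> M * Rabs q - L i q <= C') ->
  0 < eta -> S < T ->
  suboptimal N L (S + eta) (fun i t s =>
    if Rlt_dec t eta then g0 i s + C' * (eta - t) else U i (t - eta) s).
Proof.
  intros HU HU0 Hg HC Heta HS.
  assert (Hearly : forall i h s s', (i < N)%nat -> 0 < h -> 0 <= s -> 0 <= s' ->
    g0 i s' <= g0 i s + C' * h + action (L i) h (s' - s)).
  { intros i h s s' Hi Hh Hs Hs'. pose proof (Hg i s s' Hi Hs Hs').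
    pose proof (HC i ((s' - s) / h) Hi) as Hc. apply (Rmult_le_compat_l h) in Hc; [|lra].
    assert (Rabs (s' - s) = h * Rabs ((s' - s) / h)) as E.
    { rewrite <- (Rabs_pos_eq h) at 1 by lra. rewrite <- Rabs_mult. f_equal.
      field. lra. }
    rewrite E in H. unfold action. nra. }
  intros i t t' s s' Hi Ht Ht' Hs Hs'.
  destruct (Rlt_dec t' eta) as [H1|H1], (Rlt_dec t eta) as [H2|H2]; try lra.
  - pose proof (Hearly i (t' - t) s s' Hi ltac:(lra) Hs Hs'). nra.
  (* The path is cut at its position [x] at time [eta]; both pieces have the same speed, so their
     actions add up. *)
  - set (h := t' - t). set (x := s + (s' - s) / h * (eta - t)).
    assert (Hh : 0 < h) by (unfold h; lra).
    assert (Hx : 0 <= x).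
    { unfold x. replace (s + (s' - s) / h * (eta - t)) with
        (s * ((t' - eta) / h) + s' * ((eta - t) / h)) by (unfold h; field; unfold h in Hh; lra).
      assert (0 <= / h) by (left; now apply Rinv_0_lt_compat).
      apply Rplus_le_le_0_compat; apply Rmult_le_pos; auto; apply Rmult_le_pos; lra. }
    pose proof (Hearly i (eta - t) s x Hi ltac:(lra) Hs Hx) as He.
    replace (action (L i) (eta - t) (x - s)) with ((eta - t) * L i ((s' - s) / h)) in He
      by (unfold action, x; f_equal; f_equal; field; unfold h in *; lra).
    assert (U i (t' - eta) s' <= g0 i x + (t' - eta) * L i ((s' - s) / h)).
    { destruct (Req_dec t' eta) as [E|Hne].
      - assert (Ex : x = s') by (unfold x, h; rewrite E; field; lra).
        rewrite Ex, E, Rminus_diag. specialize (HU0 i s' Hi Hs'). lra.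
      - pose proof (HU i 0 (t' - eta) x s' Hi ltac:(lra) ltac:(lra) Hx Hs') as Hu.
        replace (action (L i) (t' - eta - 0) (s' - x))
          with ((t' - eta) * L i ((s' - s) / h)) in Hu.
        + specialize (HU0 i x Hi Hx). lra.
        + unfold action, x. rewrite Rminus_0_r. f_equal. f_equal.
          unfold h. field. lra. }
    unfold action. fold h. unfold h at 1. lra.
  - replace (t' - t) with (t' - eta - (t - eta)) by ring. apply HU; auto; lra.
Qed.

(** Suboptimality of the shifted sub-solution [W] supplies the inequalities at time 0 required by
    [supersolution_above_action], with [w0 = U k S a - C' * eta]; the errors vanish with [eta]. *)
Lemma branch_comparison N L T gamma L1 U V (g0 : nat -> R -> R) M C k S a :
  branch_subsolution N L T U -> branch_supersolution N L T V -> (1 <= N)%nat ->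
  (forall j, (j < N)%nat -> uniformly_convex gamma (L j) (L1 j)) -> 0 <= C ->
  (forall j r y, (j < N)%nat -> 0 <= r < T -> 0 <= y -> U j r y <= C * (1 + y)) ->
  (forall j r y, (j < N)%nat -> 0 <= r < T -> 0 <= y -> - C * (1 + y) <= V j r y) ->
  (forall j s, (j < N)%nat -> 0 <= s -> U j 0 s <= g0 j s <= V j 0 s) ->
  (forall j s s', (j < N)%nat -> 0 <= s -> 0 <= s' ->
     g0 j s' <= g0 j s + M * Rabs (s' - s)) ->
  (forall i j, (i < N)%nat -> (j < N)%nat -> g0 i 0 = g0 j 0) ->
  (k < N)%nat -> 0 < S < T -> 0 <= a -> U k S a <= V k S a.
Proof.
  intros HU HV HN HL HC HgU HgV H0 Hlip Hg0 Hk HS Ha.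
  assert (HC' : exists C', 0 <= C' /\
    forall i q, (i < N)%nat -> M * Rabs q - L i q <= C').
  { destruct (fin_bound N (fun i c => forall q, M * Rabs q - L i q <= c)) as [c Hc].
    - intros i c c' H Hcc q. specialize (H q). lra.
    - intros i Hi.
      destruct (uniformly_convex_bounded_conj gamma (L i) (L1 i) M (HL i Hi)) as [m1 H1].
      destruct (uniformly_convex_bounded_conj gamma (L i) (L1 i) (- M) (HL i Hi))
        as [m2 H2].
      exists (Rmax m1 m2). intros q. specialize (H1 q). specialize (H2 q).
      pose proof (Rmax_l m1 m2). pose proof (Rmax_r m1 m2).
      unfold Rabs. destruct (Rcase_abs q); lra.
    - exists (Rmax 0 c). split; [apply Rmax_l|]. intros i q Hi.
      specialize (Hc i Hi q). pose proof (Rmax_r 0 c). lra. }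
  destruct HC' as (C' & HC'0 & HC').
  (* [i0] is the branch with the cheapest waiting, and [qs] the outward speed on branch [k] whose
     tangent has this cost as intercept. *)
  destruct (fin_family_min unit (fun _ _ => True) (fun j _ => L j 0) N HN)
    as (i0 & _ & Hi0 & _ & Hmin0).
  { intros j _. exists tt. split; [auto|]. intros _ _. lra. }
  destruct (tangent_value_onto gamma (L k) (L1 k) (L i0 0) (HL k Hk)) as [[qs [Hqs Eqs]] _].
  { now apply (Hmin0 k tt). }
  apply Rle_plus_epsilon. intros eps Heps.
  (* The total error is [eta * (C' + L k 0)], at most [eps] once [eta <= eps / D]. *)
  set (D := C' + Rabs (L k 0) + 1).
  assert (HD : 0 < D) by (unfold D; pose proof (Rabs_pos (L k 0)); lra).
  set (eta := Rmin (T - S) (eps / D)).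
  assert (Heta : 0 < eta) by (apply Rmin_glb_lt; [lra|now apply Rdiv_lt_0_compat]).
  assert (HetaT : eta <= T - S) by apply Rmin_l.
  assert (Hetae : eta * D <= eps).
  { assert (H : eta <= eps / D) by apply Rmin_r.
    apply (Rmult_le_compat_r D) in H; [|lra].
    replace (eps / D * D) with eps in H by (field; lra). auto. }
  set (W := fun i t s =>
    if Rlt_dec t eta then g0 i s + C' * (eta - t) else U i (t - eta) s).
  assert (HW : suboptimal N L (S + eta) W).
  { apply (suboptimal_shift N L T U g0 M C' eta S); auto; try lra.
    - intros i t t' s s' Hi Ht Ht' Hs Hs'.
      apply (suboptimality N L T U C); auto. apply (HL i Hi).
    - intros i s Hi Hs. apply H0; auto. }
  assert (HWv : forall i j t, (i < N)%nat -> (j < N)%nat -> W i t 0 = W j t 0).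
  { intros i j t Hi Hj. unfold W. destruct (Rlt_dec t eta).
    - now rewrite (Hg0 i j).
    - now apply (bsub_vertex _ _ _ _ HU). }
  assert (HW0 : forall i s, (i < N)%nat -> 0 <= s -> W i 0 s <= V i 0 s + C' * eta).
  { intros i s Hi Hs. unfold W. destruct (Rlt_dec 0 eta); [|lra].
    rewrite Rminus_0_r. specialize (H0 i s Hi Hs). lra. }
  assert (HWS : W k (S + eta) a = U k S a).
  { unfold W. destruct (Rlt_dec (S + eta) eta); [lra|].
    now replace (S + eta - eta) with S by ring. }
  assert (Hmain : U k S a - C' * eta <= V k S a + eta * L k 0).
  { apply (supersolution_above_action N L T V gamma L1 C k a qs S eta); auto; try lra.
    - intros j Hj. rewrite Eqs. now apply (Hmin0 j tt).
    - intros j s rho Hj Hs Hrho Hrs. rewrite <- HWS.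
      pose proof (suboptimal_vertex_action N L (S + eta) W k i0 (L1 k) qs a
        (S + eta - rho) HW HWv Hk Hi0 Hqs Eqs Ha ltac:(lra)) as H1.
      replace (S + eta - (S + eta - rho)) with rho in H1 by ring.
      assert (H2 : W k rho 0 <= W j 0 s + action (L j) rho (0 - s)).
      { rewrite (HWv k j) by auto.
        destruct (Rle_lt_or_eq_dec 0 rho (proj1 Hrho)) as [Pr|<-].
        - pose proof (HW j 0 rho s 0 Hj ltac:(lra) ltac:(lra) Hs ltac:(lra)) as H2.
          now rewrite (Rminus_0_r rho) in H2.
        - rewrite (Hrs eq_refl), Rminus_0_r, action_0. lra. }
      specialize (HW0 j s Hj Hs). lra.
    - intros s Hs. rewrite <- HWS.
      pose proof (HW k 0 (S + eta) s a Hk ltac:(lra) ltac:(lra) Hs Ha) as H1.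
      rewrite (Rminus_0_r (S + eta)) in H1. specialize (HW0 k s Hk Hs). lra. }
  pose proof (Rle_abs (L k 0)). unfold D in Hetae.
  assert (eta * L k 0 <= eta * Rabs (L k 0)) by (apply Rmult_le_compat_l; lra).
  nra.
Qed.

Theorem mainTheorem2 (N : nat) (e : nat -> pt) (L : nat -> R -> R)
    (gamma : R) (u0 : pt -> R) (T : R) (u v : R -> pt -> R) (CT : R) :
  junction N e ->
  lipschitzJ N e u0 ->
  assumption_A1 N L gamma ->
  0 < T ->
  subsolution_init N e L T u0 u ->
  supersolution_init N e L T u0 v ->
  0 < CT ->
  (forall t x, 0 < t < T -> inJ N e x ->
     u t x <= CT * (1 + dJ N e x origin) /\
     - CT * (1 + dJ N e x origin) <= v t x) ->
  forall t x, 0 < t < T -> inJ N e x -> u t x <= v t x.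
Proof.
  intros J [K HK] [Hgam HA1] HT [Hu Hu0] [Hv Hv0] HCT Hgrow t x Ht (k & Hk & a & Ha & ->).
  pose proof J as (HN & _).
  assert (HL1 : forall i, exists F1, (i < N)%nat -> uniformly_convex gamma (L i) F1).
  { intros i. destruct (Nat.le_gt_cases N i) as [Hge|Hlt].
    - exists (L i). lia.
    - destruct (HA1 i Hlt) as (F1 & F2 & H1 & H2 & H3 & H4). exists F1. intros _.
      now apply C2_uniformly_convex with F2. }
  pose (L1 := fun i => proj1_sig (constructive_indefinite_description _ (HL1 i))).
  assert (HL : forall i, (i < N)%nat -> uniformly_convex gamma (L i) (L1 i)) by
    (intros i; exact (proj2_sig (constructive_indefinite_description _ (HL1 i)))).
  assert (Hlip : forall j s s', (j < N)%nat -> 0 <= s -> 0 <= s' ->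
     u0 (smul s' (e j)) <= u0 (smul s (e j)) + Rabs K * Rabs (s' - s)).
  { intros j s s' Hj Hs Hs'.
    pose proof (HK (smul s' (e j)) (smul s (e j)) (inJ_branch N e j s' Hj Hs')
      (inJ_branch N e j s Hj Hs)) as H.
    rewrite dJ_same in H by auto. pose proof (Rle_abs K). pose proof (Rabs_pos (s' - s)).
    pose proof (Rle_abs (u0 (smul s' (e j)) - u0 (smul s (e j)))). nra. }
  (* The growth bounds are assumed for [0 < t] only; at time 0 they come from [u0], whence the last
     two terms. *)
  set (C := CT + Rabs K + Rabs (u0 origin)).
  pose proof (Rabs_pos K). pose proof (Rabs_pos (u0 origin)).
  assert (Hu0bd : forall j y, (j < N)%nat -> 0 <= y ->
    - C * (1 + y) <= u0 (smul y (e j)) <= C * (1 + y)).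
  { intros j y Hj Hy.
    pose proof (Hlip j 0 y Hj ltac:(lra) Hy) as H1.
    pose proof (Hlip j y 0 Hj Hy ltac:(lra)) as H2.
    rewrite smul_0 in H1, H2. rewrite Rminus_0_r, (Rabs_pos_eq y) in H1 by auto.
    rewrite Rabs_minus_sym, Rminus_0_r, (Rabs_pos_eq y) in H2 by auto.
    pose proof (Rle_abs (u0 origin)). pose proof (Rle_abs (- u0 origin)) as H4.
    rewrite Rabs_Ropp in H4. unfold C. nra. }
  assert (Hdist : forall j y, (j < N)%nat -> 0 <= y -> dJ N e (smul y (e j)) origin = y).
  { intros j y Hj Hy. rewrite <- (smul_0 (e j)), dJ_same by (auto; lra).
    rewrite Rminus_0_r. now apply Rabs_pos_eq. }
  apply (branch_comparison N L T gamma L1 (fun i t s => u t (smul s (e i)))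
    (fun i t s => v t (smul s (e i))) (fun i s => u0 (smul s (e i))) (Rabs K) C k t a); auto.
  - apply subsolution_branch; auto. intros i p Hi.
    now apply uniformly_convex_bounded_conj with gamma (L1 i), HL.
  - now apply supersolution_branch.
  - unfold C. lra.
  - intros j r y Hj Hr Hy. destruct (Rle_lt_or_eq_dec 0 r (proj1 Hr)) as [Pr|<-].
    + destruct (Hgrow r (smul y (e j)) ltac:(lra) (inJ_branch N e j y Hj Hy)) as [H1 _].
      rewrite Hdist in H1 by auto. unfold C. nra.
    + eapply Rle_trans; [apply Hu0, inJ_branch; auto|]. now apply Hu0bd.
  - intros j r y Hj Hr Hy. destruct (Rle_lt_or_eq_dec 0 r (proj1 Hr)) as [Pr|<-].
    + destruct (Hgrow r (smul y (e j)) ltac:(lra) (inJ_branch N e j y Hj Hy)) as [_ H1].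
      rewrite Hdist in H1 by auto. unfold C. nra.
    + eapply Rle_trans; [|apply Hv0, inJ_branch; auto]. now apply Hu0bd.
  - intros j s Hj Hs. split; [apply Hu0|apply Hv0]; now apply inJ_branch.
  - intros i j _ _. now rewrite !smul_0.
Qed.
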